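(* Let $\Phi$ be the Ginibre point process in $\mathbb{R}^2\cong\mathbb{C}$. Then for each $k\ge1$ there exists a constant $C_{d,k}>0$ (here $d=2$) such that for $r_n\ge C_{d,k}(\log n)^{1/4}$, w.h.p. $\beta_k(R(\Phi_n,r_n))=0$.
   Context: Point processes are simple and identified with their random sets of points, and are normalized to be stationary with unit intensity. The $k$th joint intensity $\rho^{(k)}$ is the Lebesgue density of the intensity measure of the set of ordered $k$-tuples of pairwise distinct points. The (unit intensity) Ginibre process is the determinantal point process on $\mathbb{C}$, $\rho^{(k)}(z_1,\ldots,z_k)=\det(K(z_i,z_j))_{1\le i,j\le k}$ for all $k\geq 1$, with $K(z,w)=\exp(-\frac{\pi}{2}(|z|^2+|w|^2)+\pi z\overline{w})$. $W_n=[-n^{1/2}/2,n^{1/2}/2]^2$, $\Phi_n=\Phi\cap W_n$. For a finite point set $P$ and $\varepsilon>0$, the Vietoris–Rips complex $R(P,\varepsilon)$ has as $m$-simplices the subsets $\{x_{i_0},\ldots,x_{i_m}\}\subset P$ with $B_{x_{i_l}}(\varepsilon/2)\cap B_{x_{i_{l'}}}(\varepsilon/2)\ne\varnothing$ for all pairs, $B_x(r)$ being the ball of radius $r$ centred at $x$. $\beta_k$ is the $k$th Betti number (homology over $\mathbb{Z}_2$). W.h.p. means with probability tending to $1$ as $n\to\infty$. *)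

(* Defs.v *)
From HB Require Import structures.
From mathcomp Require Export all_boot all_order all_algebra finmap.
From mathcomp Require Export all_classical all_reals all_analysis.
From mathcomp Require Export measurable_realfun complex.

Set Implicit Arguments.
Unset Strict Implicit.
Unset Printing Implicit Defensive.

Import Order.TTheory GRing.Theory Num.Theory.
Export numFieldNormedType.Exports.

Local Open Scope classical_set_scope.
Local Open Scope ring_scope.

(* The library also proves this, but its instance is shadowed by the one for
   products of subprobabilities. *)
Lemma sigma_finite_product {d1 d2 : measure_display} {T1 : measurableType d1}
    {T2 : measurableType d2} {R : realType}
    (m1 : {sigma_finite_measure set T1 -> \bar R})
    (m2 : {sigma_finite_measure set T2 -> \bar R}) :
  sigma_finite setT (m1 \x m2)%E.
Proof.
have /sigma_finiteP[F [TF ndF Foo]] := sigma_finiteT m1.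
have /sigma_finiteP[G [TG ndG Goo]] := sigma_finiteT m2.
exists (fun n => F n `*` G n).
  rewrite -setXTT TF TG predeqE => -[x y]; split.
    move=> [/= [n _ Fnx] [k _ Gky]]; exists (maxn n k) => //; split.
    - by move: x Fnx; exact/subsetPset/ndF/leq_maxl.
    - by move: y Gky; exact/subsetPset/ndG/leq_maxr.
  by move=> [n _ []/= ? ?]; split; exists n.
move=> k; have [? ?] := Foo k; have [? ?] := Goo k.
split; first exact: measurableX.
by rewrite product_measure1E// lte_mul_pinfty// ge0_fin_numE.
Qed.

Section tuple_measure.
Context {d : measure_display} {T : measurableType d} {R : realType}.

Definition tuple_cons k (p : T * k.-tuple T) : k.+1.-tuple T :=
  [the k.+1.-tuple T of p.1 :: p.2].

Definition tuple_uncons k (t : k.+1.-tuple T) : T * k.-tuple T :=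
  (thead t, [tuple of behead t]).

Lemma measurable_tuple_cons k : measurable_fun setT (@tuple_cons k).
Proof. by apply: measurable_cons. Qed.

Lemma measurable_tuple_uncons k : measurable_fun setT (@tuple_uncons k).
Proof.
apply/measurable_fun_pairP; split.
  exact: measurable_tnth.
exact: measurable_behead.
Qed.

Lemma tuple_consK k : cancel (@tuple_cons k) (@tuple_uncons k).
Proof.
move=> [x t]; rewrite /tuple_uncons /tuple_cons theadE /=; congr pair.
exact: val_inj.
Qed.

Lemma tuple_unconsK k : cancel (@tuple_uncons k) (@tuple_cons k).
Proof. by move=> t; rewrite [RHS]tuple_eta; apply: val_inj. Qed.

HB.instance Definition _ k :=
  isMeasurableFun.Build _ _ _ _ (@tuple_cons k)
    (@measurable_tuple_cons k).

Section step.
Variables (k : nat) (mu : {sigma_finite_measure set T -> \bar R}).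
Variable nu : {sigma_finite_measure set (k.-tuple T) -> \bar R}.

Definition tuple_measureS : set (k.+1.-tuple T) -> \bar R :=
  pushforward (mu \x nu)%E (@tuple_cons k).

Let tuple_measureS0 : tuple_measureS set0 = 0%E.
Proof. exact: measure0. Qed.

Let tuple_measureS_ge0 A : (0 <= tuple_measureS A)%E.
Proof. exact: measure_ge0. Qed.

Let tuple_measureS_sigma_additive : semi_sigma_additive tuple_measureS.
Proof. exact: measure_semi_sigma_additive. Qed.

HB.instance Definition _ := isMeasure.Build _ _ _ tuple_measureS
  tuple_measureS0 tuple_measureS_ge0 tuple_measureS_sigma_additive.

Lemma sigma_finite_tuple_measureS : sigma_finite setT tuple_measureS.
Proof.
have [F UF mF] := sigma_finite_product mu nu.
exists (fun i => @tuple_uncons k @^-1` F i).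
  by rewrite -preimage_bigcup -UF preimage_setT.
move=> i; have [mFi Fioo] := mF i; split.
  by rewrite -[X in measurable X]setTI; exact: measurable_tuple_uncons.
rewrite /tuple_measureS /pushforward -comp_preimage.
by rewrite (_ : _ \o _ = id) //; apply/funext => p; exact: tuple_consK.
Qed.

HB.instance Definition _ :=
  Measure_isSigmaFinite.Build _ _ _ tuple_measureS sigma_finite_tuple_measureS.

End step.

(* The [k]-fold product measure of [mu]. *)
Fixpoint tuple_measure (mu : {sigma_finite_measure set T -> \bar R}) (k : nat) :
    {sigma_finite_measure set (k.-tuple T) -> \bar R} :=
  match k with
  | 0 => \d_ ([tuple] : 0.-tuple T)
  | k'.+1 => tuple_measureS mu (tuple_measure mu k')
  end.

End tuple_measure.

(* [measurableTypeR R] is [R] with the Borel sigma-algebra carried by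
   [lebesgue_measure]. *)
Notation plane R := (measurableTypeR R * measurableTypeR R)%type.

Section planar_point_process.
Context {R : realType}.
Local Notation plane := (plane R).

Definition plane_lebesgue : set plane -> \bar R :=
  (lebesgue_measure \x lebesgue_measure)%E.

HB.instance Definition _ := Measure.on plane_lebesgue.
HB.instance Definition _ := Measure_isSigmaFinite.Build _ _ _ plane_lebesgue
  (sigma_finite_product lebesgue_measure lebesgue_measure).

Section defs.
Context {d : measure_display} {Omega : measurableType d}.
Variables (P : probability Omega R) (Phi : Omega -> set plane).

Definition point_count (B : set plane) (w : Omega) : \bar R :=
  counting (Phi w `&` B).

(* Simplicity is built in: a realization is a set of points. *)
Definition point_process : Prop :=
  (forall (w : Omega) (B : set plane),
     bounded_set B -> finite_set (Phi w `&` B)) /\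
  (forall B : set plane, measurable B ->
     measurable_fun setT (point_count B)).

Definition distinct_tuples (k : nat) (w : Omega) : set (k.-tuple plane) :=
  [set t : k.-tuple plane | uniq t /\ forall i : 'I_k, Phi w (tnth t i)].

Definition joint_intensity (k : nat) (rho : k.-tuple plane -> R) : Prop :=
  [/\ measurable_fun setT rho, forall t, 0 <= rho t &
      forall B : set (k.-tuple plane), measurable B ->
        (\int[P]_w counting (distinct_tuples w `&` B) =
         \int[tuple_measure plane_lebesgue k]_(t in B) (rho t)%:E)%E].

Definition plane_to_C (z : R * R) : R[i] := Complex z.1 z.2.

Definition determinantal (K : R[i] -> R[i] -> R[i]) : Prop :=
  forall k : nat, (1 <= k)%N ->
    exists rho : k.-tuple plane -> R,
      joint_intensity rho /\
      forall t : k.-tuple plane,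
        real_complex R (rho t) =
        \det (\matrix_(i < k, j < k)
                K (plane_to_C (tnth t i)) (plane_to_C (tnth t j))).

End defs.

Definition expC (z : R[i]) : R[i] :=
  real_complex R (expR (complex.Re z)) *
  Complex (cos (complex.Im z)) (sin (complex.Im z)).

Definition ginibre_kernel (z w : R[i]) : R[i] :=
  expC (- (real_complex R pi / 2) * (`|z| ^+ 2 + `|w| ^+ 2)
        + real_complex R pi * z * conjc w).

Definition ginibre {d : measure_display} {Omega : measurableType d}
    (P : probability Omega R) (Phi : Omega -> set plane) : Prop :=
  point_process Phi /\ determinantal P Phi ginibre_kernel.

Definition window (n : nat) : set plane :=
  let a := Num.sqrt n%:R / 2 in `[- a, a] `*` `[- a, a].

(* The library's [ball] on [plane] is the one of the sup norm. *)
Definition euclidean_ball (x : R * R) (r : R) : set plane :=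
  [set y | Num.sqrt ((y.1 - x.1) ^+ 2 + (y.2 - x.2) ^+ 2) <= r].

Definition rips (X : {fset plane}) (eps : R) : {set {set X}} :=
  [set s : {set X} | (s != finset.set0) &&
    [forall x in s, forall y in s,
      `[< euclidean_ball (val x) (eps / 2) `&` euclidean_ball (val y) (eps / 2)
          !=set0 >]]]%SET.

End planar_point_process.

Section betti.
Variable V : finType.

Local Notation chains := {ffun {set V} -> ('F_2)^o}.

(* A chain is given by its coefficients; the coefficient of the boundary of [c]
   at a face [t] is the sum of the coefficients of the [v |: t], [v \notin t].
   The empty set is not a face: homology is not reduced. *)
Definition boundary (c : chains) : chains :=
  [ffun t : {set V} => if t == finset.set0 then 0
             else \sum_(v | v \notin t) c (v |: t)%SET].

Lemma boundary_linear : linear boundary.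
Proof.
move=> a b c; apply/ffunP => t; rewrite !ffunE.
case: ifP => _; first by rewrite scaler0 addr0.
by rewrite scaler_sumr -big_split; apply: eq_bigr => v _; rewrite !ffunE.
Qed.

HB.instance Definition _ :=
  GRing.isLinear.Build 'F_2 chains chains _ boundary boundary_linear.

Definition simplex_chain (s : {set V}) : chains :=
  [ffun t => if t == s then 1 else 0].

Definition chain_space (K : {set {set V}}) (m : nat) : {vspace chains} :=
  <<[seq simplex_chain s | s : {set V} <- enum K & #|s| == m.+1]>>%VS.

Definition cycle_space (K : {set {set V}}) (m : nat) : {vspace chains} :=
  (chain_space K m :&: lker (linfun boundary))%VS.

Definition boundary_space (K : {set {set V}}) (m : nat) : {vspace chains} :=
  (linfun boundary @: chain_space K m.+1)%VS.

(* For [K] a simplicial complex, boundaries are cycles, so this is the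
   dimension of the quotient. *)
Definition betti (m : nat) (K : {set {set V}}) : nat :=
  (\dim (cycle_space K m) - \dim (boundary_space K m))%N.

End betti.

(* Main.v *)
From HB Require Import structures.
Require Import Defs.
From mathcomp Require Import fingroup perm ring lra.

(** The proof has a deterministic half and a probabilistic half, joined by a
    union bound.

    Deterministic half.  Let X be a finite subset of a convex set W containing
    the origin, such that every point of W is within r / 20 of X.  Then the Rips
    complex of X at scale r is dismantlable: its vertices can be removed one at
    a time, each having a dismantlable link at the time of its removal, until a
    cone is left ([dismantlable_dense]).  Points are removed by decreasing
    distance to the origin.  The link of the farthest point x lies in the lens
    cut out of the disc of radius r about x by the circle through x centred at
    the origin.  Let q be the point at distance r / 2 from x towards the origin.
    A point z of the lens that is not adjacent to a point of X near q is
    dominated by a point of X near (3 z + q) / 4, so the link is dismantled by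
    decreasing distance to q ([lens_dominated]).  A Mayer-Vietoris argument on
    chains shows that dismantlable complexes are acyclic
    ([dismantlable_acyclic]); hence no positive Betti number survives.

    Probabilistic half.  The number of points of the Ginibre process in a disc
    D of radius rho has the factorial moments of a sum of independent Bernoulli
    variables of parameters lambda_j, the eigenvalues of the kernel on D
    ([disc_moment_cvg]).  To see this one expands the determinant over the
    monomials z ^ j, which are orthogonal on the disc because the area is
    rotation invariant; the exponential series of the kernel is truncated and
    the limit taken by dominated convergence.  Bonferroni's inequality then
    bounds the probability of an empty disc by the product of the
    1 - lambda_j ([disc_void_le_prod]).  Since 1 - lambda_j is at most
    2 ^ (j + 1) exp (- pi rho ^ 2 / 2), the factors of index below
    rho ^ 2 / 2 are each at most exp (- rho ^ 2 / 2), and the product is at most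
    exp (- rho ^ 4 / 8) ([void_probability_le]).  This fourth power
    is the origin of the exponent 1 / 4 of the logarithm.

    Union bound.  Cut the window of area n into at most n squares of side s
    between 4 (ln n) ^ (1/4) and twice that.  A given inscribed disc is empty
    with probability at most exp (- s ^ 4 / 128), hence at most n ^ (-2), so
    with probability at least 1 - 1 / n all of them contain a point, and the
    deterministic half applies as soon as r is at least 40 s.

    The probability of a set is meaningful only for an event, and the vanishing
    of homology is shown to be one by approximating the points by the cells of
    finer and finer grids ([measurable_betti_event]). *)

Set Implicit Arguments.
Unset Strict Implicit.
Unset Printing Implicit Defensive.
Import Order.TTheory GRing.Theory Num.Theory.
Import Normc.
Local Open Scope ring_scope.

(** * Homology of dismantlable clique complexes *)

Section flag.
Variables (V : finType) (e : rel V).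
Hypotheses (e_refl : reflexive e) (e_sym : symmetric e).

Local Notation chains := ({set V} -> 'F_2).

Definition clique (s : {set V}) := [forall x in s, forall y in s, e x y].

Definition flag_complex : {set {set V}} :=
  [set s : {set V} | (s != finset.set0) && clique s]%SET.

Definition link (S : {set V}) (z : V) : {set V} :=
  [set w in S | (w != z) && e z w]%SET.

(** The empty face is allowed, so that homology is reduced and the link of an
    isolated vertex fails to be acyclic; this is what makes the induction on
    links uniform in the dimension. *)
Definition augmented_boundary (c : chains) : chains :=
  fun t => \sum_(v | v \notin t) c (v |: t)%SET.

Definition supported (S : {set V}) (c : chains) : Prop :=
  forall s, c s != 0 -> clique s && (s \subset S).

(** Chains are not graded by dimension: the homogeneous part of the right
    dimension of a filling is again a filling. *)
Definition acyclic (S : {set V}) : Prop :=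
  forall c, supported S c -> (forall t, augmented_boundary c t = 0) ->
    exists2 b, supported S b & forall t, augmented_boundary b t = c t.

(** These are the contractible graphs in the sense of Ivashchenko, with cones
    as base case. *)
Inductive dismantlable : {set V} -> Prop :=
| dismantlable_cone (S : {set V}) y : y \in S -> (forall z, z \in S -> e y z) ->
    dismantlable S
| dismantlable_remove (S : {set V}) z : z \in S -> dismantlable (link S z) ->
    dismantlable (S :\ z)%SET -> dismantlable S.

Lemma cliqueP (s : {set V}) : reflect {in s &, forall x y, e x y} (clique s).
Proof.
apply: (iffP forall_inP) => [h x y xs ys|h x xs].
  by have /forall_inP := h x xs; exact.
by apply/forall_inP => y ys; exact: h.
Qed.

Lemma sub_clique (s t : {set V}) : s \subset t -> clique t -> clique s.
Proof.
move=> /fintype.subsetP st /cliqueP ct; apply/cliqueP => x y xs ys.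
by apply: ct; apply: st.
Qed.

Lemma F2_oppr (x : 'F_2) : - x = x.
Proof. by apply: (oppr_pchar2 (pchar_Fp (isT : prime 2))). Qed.

Lemma F2_addrr (x : 'F_2) : x + x = 0.
Proof. by rewrite -{1}(F2_oppr x) addNr. Qed.

Lemma F2_addr_eq0 (x y : 'F_2) : x + y = 0 -> x = y.
Proof. by move/eqP; rewrite addr_eq0 F2_oppr => /eqP. Qed.

Lemma setU1D1 (y v : V) (t : {set V}) : y \in t -> v \notin t ->
  ((v |: t) :\ y = v |: (t :\ y))%SET.
Proof.
move=> yt vt; apply/setP => x; rewrite !inE; case: (x =P v) => [->|] //=.
by rewrite andbT; apply: contraNneq vt => ->.
Qed.

(** Coning with apex [y] is a chain homotopy from the identity to zero. *)
Lemma acyclic_cone (S : {set V}) y : y \in S -> (forall z, z \in S -> e y z) -> acyclic S.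
Proof.
move=> yS ey c cS c0.
exists (fun s : {set V} => if y \in s then c (s :\ y)%SET else 0).
  move=> s; case: ifP => [ys /cS /andP[/cliqueP cs /fintype.subsetP sS]|]; last by rewrite eqxx.
  have sS' x : x \in s -> x \in S.
    by move=> xs; have [->//|xy] := eqVneq x y; apply: sS; rewrite !inE xy.
  apply/andP; split; last exact/fintype.subsetP.
  apply/cliqueP => u v us vs.
  have [->|uy] := eqVneq u y; first exact/ey/sS'.
  have [->|vy] := eqVneq v y; first by rewrite e_sym; exact/ey/sS'.
  by apply: cs; rewrite !inE ?uy ?vy.
move=> t; rewrite /augmented_boundary.
have [yt|yt] := boolP (y \in t).
  rewrite (eq_bigr (fun v => c (v |: (t :\ y))%SET)); last first.
    by move=> v vt; rewrite !inE yt orbT setU1D1.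
  have /esym := c0 (t :\ y)%SET.
  rewrite /augmented_boundary (bigD1 y) /=; last by rewrite !inE eqxx.
  rewrite finset.setD1K // => /esym/F2_addr_eq0 ->; apply: eq_bigl => v.
  by rewrite !inE; case: eqVneq => [->|] //=; rewrite ?andbT ?yt.
rewrite (bigD1 y) //= finset.setU11 finset.setU1K // big1 ?addr0 // => v /andP[vt vy].
by rewrite !inE eq_sym (negbTE vy) (negbTE yt).
Qed.

(** A cycle [c] restricts to a cycle [a] on the link of [z]; if [b] fills [a],
    then adding the boundary of the cone over [b] with apex [z] moves [c] off
    [z]. *)
Lemma acyclic_remove (S : {set V}) z : z \in S -> acyclic (link S z) ->
  acyclic (S :\ z)%SET -> acyclic S.
Proof.
move=> zS aL aD c cS c0.
pose a (t : {set V}) := if z \in t then 0 else c (z |: t)%SET.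
have aS : supported (link S z) a.
  move=> t; rewrite /a; case: ifPn; rewrite ?eqxx // => zt /cS /andP[ct tS].
  rewrite (sub_clique _ ct) ?finset.subsetUr //=; apply/fintype.subsetP => x xt.
  rewrite inE; apply/and3P; split.
  - by apply: (fintype.subsetP tS); rewrite inE xt orbT.
  - by apply: contraNneq zt => <-.
  - by move/cliqueP: ct; apply; rewrite !inE ?eqxx ?xt ?orbT.
have a0 t : augmented_boundary a t = 0.
  rewrite /augmented_boundary; have [zt|zt] := boolP (z \in t).
    by rewrite big1 // => v _; rewrite /a inE zt orbT.
  rewrite (bigD1 z) //= {1}/a finset.setU11 add0r -[RHS](c0 (z |: t)%SET).
  apply: congr_big => // v; first by rewrite !inE negb_or andbC.
  by move=> /andP[vt vz]; rewrite /a !inE eq_sym (negbTE vz) (negbTE zt) /= finset.setUCA.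
have [b bS bd] := aL _ aS a0.
have bz (t : {set V}) : z \in t -> b t = 0.
  move=> zt; apply: contraTeq isT => /bS /andP[_ /fintype.subsetP /(_ _ zt)].
  by rewrite !inE eqxx andbF.
pose b1 (s : {set V}) := if z \in s then b (s :\ z)%SET else 0.
have b1S : supported S b1.
  move=> s; rewrite /b1; case: ifP; rewrite ?eqxx // => zs /bS /andP[/cliqueP cs sL].
  have sL' x : x \in s -> x != z -> (x \in S) /\ e z x.
    move=> xs xz; have := fintype.subsetP sL x; rewrite !inE xz xs => /(_ isT).
    by move=> /andP[].
  apply/andP; split; last first.
    apply/fintype.subsetP => x xs; have [->//|xz] := eqVneq x z.
    by case: (sL' x xs xz).
  apply/cliqueP => u v us vs.
  have [->|uz] := eqVneq u z.
    have [->|vz] := eqVneq v z; first exact: e_refl.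
    by case: (sL' v vs vz).
  have [->|vz] := eqVneq v z; first by rewrite e_sym; case: (sL' u us uz).
  by apply: cs; rewrite !inE ?uz ?vz.
have bd1 (t : {set V}) : augmented_boundary b1 t = if z \in t then c t else b t.
  rewrite /augmented_boundary; case: ifPn => zt.
    rewrite (eq_bigr (fun v => b (v |: (t :\ z))%SET)); last first.
      by move=> v vt; rewrite /b1 !inE zt orbT setU1D1.
    have := bd (t :\ z)%SET; rewrite /augmented_boundary (bigD1 z) /=; last by rewrite !inE eqxx.
    rewrite finset.setD1K // bz // add0r /a !inE eqxx /= finset.setD1K // => <-.
    by apply: eq_bigl => v; rewrite !inE; case: eqVneq => [->|] //=; rewrite ?andbT ?zt.
  rewrite (bigD1 z) //= {1}/b1 finset.setU11 finset.setU1K // big1 ?addr0 // => v /andP[vt vz].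
  by rewrite /b1 !inE eq_sym (negbTE vz) (negbTE zt).
pose c1 (t : {set V}) := c t + augmented_boundary b1 t.
have c1S : supported (S :\ z)%SET c1.
  move=> t; rewrite /c1 bd1; case: ifPn; rewrite ?F2_addrr ?eqxx // => zt.
  have [ct|ct] := eqVneq (c t) 0.
    rewrite ct add0r => /bS /andP[-> /= /fintype.subsetP tL].
    by apply/fintype.subsetP => x /tL; rewrite !inE => /and3P[-> ->].
  move=> _; have /andP[-> /= tS] := cS _ ct.
  by rewrite finset.subsetD1 tS zt.
have c10 t : augmented_boundary c1 t = 0.
  rewrite /augmented_boundary; have [zt|zt] := boolP (z \in t).
    by rewrite big1 // => v _; rewrite /c1 bd1 inE zt orbT F2_addrr.
  rewrite (bigD1 z) //= {1}/c1 bd1 finset.setU11 F2_addrr add0r.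
  rewrite (eq_bigr (fun v => c (v |: t)%SET + b (v |: t)%SET)); last first.
    by move=> v /andP[vt vz]; rewrite /c1 bd1 !inE eq_sym (negbTE vz) (negbTE zt).
  rewrite big_split /=.
  have := c0 t; rewrite /augmented_boundary (bigD1 z) //= => /F2_addr_eq0 <-.
  have := bd t; rewrite /augmented_boundary (bigD1 z) //= bz ?finset.setU11 // add0r => ->.
  by rewrite /a (negbTE zt) F2_addrr.
have [b2 b2S bd2] := aD _ c1S c10.
exists (fun s : {set V} => b1 s + b2 s).
  move=> s; have [b1s|b1s] := eqVneq (b1 s) 0; last by move=> _; exact: b1S.
  rewrite b1s add0r => /b2S /andP[-> /= sS].
  exact: (fintype.subset_trans sS (finset.subD1set _ _)).
move=> t; rewrite {1}/augmented_boundary big_split /= -!/(augmented_boundary _ t).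
have := bd2 t; rewrite /augmented_boundary => ->; rewrite /c1.
by rewrite /augmented_boundary addrCA F2_addrr addr0.
Qed.

Lemma dismantlable_acyclic (S : {set V}) : dismantlable S -> acyclic S.
Proof.
elim=> [{}S y yS ey|{}S z zS _ aL _ aD]; first exact: (acyclic_cone yS ey).
exact: (acyclic_remove zS aL aD).
Qed.

(** The link of a dominated vertex is a cone over the dominating vertex. *)
Lemma dismantlable_dominated (S : {set V}) z y : z \in S -> y \in S -> y != z ->
  (forall w, w \in S -> e z w -> e y w) ->
  dismantlable (S :\ z)%SET -> dismantlable S.
Proof.
move=> zS yS yz dom; apply: (dismantlable_remove zS).
apply: (@dismantlable_cone _ y) => [|w]; rewrite !inE ?yS ?yz /=.
  by rewrite e_sym; apply: (dom _ zS (e_refl z)).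
by move=> /and3P[wS _ /(dom _ wS)].
Qed.

End flag.

Section betti_support.
Variable V : finType.
Local Notation chains := {ffun {set V} -> ('F_2)^o}.

Lemma in_chain_space (K : {set {set V}}) m (c : chains) :
  reflect (forall s, c s != 0 -> (s \in K) && (#|s| == m.+1))
    (c \in chain_space K m).
Proof.
apply: (iffP idP) => [|h].
  rewrite /chain_space; set X := [seq _ | _ <- _ & _] => cX s.
  rewrite (@coord_span _ _ _ (in_tuple X) c cX).
  apply: contraR => sK; apply/eqP; rewrite sum_ffunE big1 // => i _.
  rewrite ffunE.
  have := @mem_nth chains 0 X _ (ltn_ord i).
  move=> /mapP[s']; rewrite mem_filter mem_enum => /andP[cs' Ks'] ->.
  rewrite ffunE; case: eqP => [ss|_]; last by rewrite scaler0.
  by move: sK; rewrite ss Ks' cs'.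
have -> : c = \sum_s c s *: simplex_chain s.
  apply/ffunP => t; rewrite sum_ffunE (bigD1 t) //= !ffunE eqxx big1 ?addr0.
    by rewrite /GRing.scale /= mulr1.
  by move=> s st; rewrite !ffunE eq_sym (negbTE st) scaler0.
apply: memv_suml => s _; have [->|/h /andP[sK cs]] := eqVneq (c s) 0.
  by rewrite scale0r mem0v.
apply/memvZ/memv_span/mapP; exists s => //.
by rewrite mem_filter cs mem_enum.
Qed.

Lemma in_cycle_space (K : {set {set V}}) m (c : chains) :
  (c \in cycle_space K m) = (c \in chain_space K m) && (boundary c == 0).
Proof. by rewrite memv_cap memv_ker lfunE. Qed.

Lemma in_boundary_space (K : {set {set V}}) m (c : chains) :
  reflect (exists2 b, b \in chain_space K m.+1 & c = boundary b)
    (c \in boundary_space K m).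
Proof.
apply: (iffP memv_imgP) => -[b bK ->]; exists b => //; rewrite lfunE //.
Qed.

Lemma augmented_boundaryE (c : chains) t : t != finset.set0 ->
  boundary c t = augmented_boundary c t.
Proof. by move=> t0; rewrite ffunE (negbTE t0). Qed.

(** For [k] at least 1 the faces of a [k]-chain have at least two vertices, so
    the boundary with and without the empty face agree. *)
Lemma dismantlable_betti0 (e : rel V) k : reflexive e -> symmetric e ->
  (1 <= k)%N -> dismantlable e [set: V] -> betti k (flag_complex e) = 0%N.
Proof.
move=> er es k1 /(dismantlable_acyclic er es) ac.
apply/eqP; rewrite subn_eq0; apply: dimvS; apply/subvP => c.
rewrite in_cycle_space => /andP[/in_chain_space cK /eqP bc].
have cS : supported e [set: V] c.
  by move=> s /cK; rewrite inE => /andP[/andP[_ ->]] _; rewrite finset.subsetT.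
have c0 t : augmented_boundary c t = 0.
  have [->|t0] := eqVneq t finset.set0; last first.
    by rewrite -augmented_boundaryE // bc ffunE.
  rewrite /augmented_boundary big1 // => v _; apply: contraTeq isT => /cK /andP[_].
  by rewrite finset.setU0 cards1; case: k k1 {cK}.
have [b bS bd] := ac _ cS c0.
(* Only the part of the filling of the right dimension is kept. *)
pose b' : chains := [ffun s : {set V} => if #|s| == k.+2 then b s else 0].
apply/in_boundary_space; exists b'.
  apply/in_chain_space => s; rewrite ffunE; case: ifP => [cs /bS|]; last by rewrite eqxx.
  rewrite inE => /andP[-> _]; rewrite !andbT -cards_eq0.
  by move/eqP: cs => ->.
apply/ffunP => t; rewrite ffunE; case: ifP => [/eqP->|t0].
  apply: contraTeq isT => /cK /andP[_]; by rewrite cards0.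
have [kt|kt] := eqVneq #|t| k.+1.
  rewrite -bd; apply: eq_bigr => v vt; rewrite ffunE.
  by rewrite cardsU1 vt kt eqxx.
rewrite big1.
  by apply: contraNeq kt => /cK /andP[].
move=> v vt; rewrite ffunE cardsU1 vt eqSS (_ : (_ == _) = false) //.
exact: negbTE.
Qed.

End betti_support.

(** * Graph isomorphisms preserve Betti numbers *)

Section betti_isomorphism.
Variables (V V' : finType) (g : V -> V') (g' : V' -> V).
Hypotheses (gK : cancel g g') (g'K : cancel g' g).
Variables (e : rel V) (e' : rel V').
Hypothesis ee' : forall x y, e x y = e' (g x) (g y).
Local Notation chains := {ffun {set V} -> ('F_2)^o}.
Local Notation chains' := {ffun {set V'} -> ('F_2)^o}.

Definition transport (c : chains) : chains' := [ffun t : {set V'} => c (g @^-1: t)%SET].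

Lemma transport_linear : linear transport.
Proof. by move=> a b c; apply/ffunP => t; rewrite !ffunE. Qed.

HB.instance Definition _ :=
  GRing.isLinear.Build 'F_2 chains chains' _ transport transport_linear.

Let g_inj : injective g := can_inj gK.

Let imK (t : {set V}) : (g @^-1: (g @: t) = t)%SET.
Proof. by apply/setP => x; rewrite inE mem_imset. Qed.

Let preK (t : {set V'}) : (g @: (g @^-1: t) = t)%SET.
Proof.
apply/setP => y; apply/imsetP/idP => [[x xt ->]|yt]; first by rewrite inE in xt.
by exists (g' y); rewrite ?inE g'K.
Qed.

Lemma flag_complex_imset (t : {set V}) :
  ((g @: t)%SET \in flag_complex e') = (t \in flag_complex e).
Proof.
rewrite !inE imset_eq0; congr (_ && _).
apply/cliqueP/cliqueP => ct x y.
  by move=> xt yt; rewrite ee'; apply: ct; exact: imset_f.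
by move=> /imsetP[u ut ->] /imsetP[v vt ->]; rewrite -ee'; exact: ct.
Qed.

Let transportE c (t : {set V}) : transport c (g @: t)%SET = c t.
Proof. by rewrite ffunE imK. Qed.

Lemma transport_chain_space c m :
  (transport c \in chain_space (flag_complex e') m) = (c \in chain_space (flag_complex e) m).
Proof.
apply/in_chain_space/in_chain_space => h t.
  by rewrite -transportE => /h; rewrite flag_complex_imset card_imset.
by rewrite -[t]preK transportE flag_complex_imset card_imset //; exact: h.
Qed.

Lemma boundary_transport c : boundary (transport c) = transport (boundary c).
Proof.
apply/ffunP => t; rewrite !ffunE -{1}[t]preK imset_eq0; case: ifP => // _.
rewrite (reindex g) /=; last by exists g' => x _; rewrite ?gK ?g'K.
apply: eq_big => v; first by rewrite inE.
move=> vt; rewrite ffunE; congr (c _).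
by apply/setP => x; rewrite !inE (inj_eq g_inj).
Qed.

Lemma transport_surj c' : exists c, c' = transport c.
Proof.
exists [ffun t : {set V} => c' (g @: t)%SET].
by apply/ffunP => t; rewrite !ffunE preK.
Qed.

Lemma transport_inj : injective transport.
Proof.
by move=> c d /ffunP cd; apply/ffunP => t; have := cd (g @: t)%SET; rewrite !transportE.
Qed.

Let dim_transport (U : {vspace chains}) (U' : {vspace chains'}) :
  (forall c, (transport c \in U') = (c \in U)) -> \dim U' = \dim U.
Proof.
move=> h; have -> : U' = (linfun transport @: U)%VS.
  apply/vspaceP => c'; have [c ->] := transport_surj c'; rewrite h.
  apply/idP/memv_imgP => [cU|[d dU]]; first by exists c; rewrite ?lfunE.
  by rewrite lfunE /= => /transport_inj ->.
apply: limg_dim_eq; apply/eqP; rewrite -subv0; apply/subvP => c.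
rewrite memv_cap memv_ker memv0 lfunE /= => /andP[_ /eqP c0].
by apply/eqP/transport_inj; rewrite c0 linear0.
Qed.

Lemma betti_isomorphism m : betti m (flag_complex e) = betti m (flag_complex e').
Proof.
rewrite /betti; congr (_ - _)%N; symmetry; apply: dim_transport => c.
  rewrite !in_cycle_space transport_chain_space boundary_transport; congr (_ && _).
  by rewrite -{1}[0](linear0 transport) (inj_eq transport_inj).
apply/in_boundary_space/in_boundary_space => -[b bK].
  have [d bE] := transport_surj b; rewrite bE boundary_transport => /transport_inj ->.
  by exists d => //; rewrite -transport_chain_space -bE.
by move=> ->; exists (transport b); rewrite ?transport_chain_space ?boundary_transport.
Qed.

End betti_isomorphism.

Section betti_of_points.
Variables (T T' : choiceType) (e : rel T) (e' : rel T') (f : T -> T') (X : {fset T}).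

Definition point_graph (T : choiceType) (e : rel T) (X : {fset T}) : {set {set X}} :=
  flag_complex (fun x y : X => e (val x) (val y)).

(** Only the adjacency relation between the points enters the clique complex,
    which allows points of the plane to be replaced by grid cells. *)
Lemma betti_point_graph_image m :
  {in X &, injective f} -> {in X &, forall x y, e x y = e' (f x) (f y)} ->
  betti m (point_graph e X) = betti m (point_graph e' (f @` X)%fset).
Proof.
move=> f_inj ee'.
have fX (x : X) : f (val x) \in (f @` X)%fset by apply/imfsetP; exists (val x) => //=; exact: fsvalP.
pose g (x : X) : (f @` X)%fset := [` fX x]%fset.
have g_inj : injective g.
  move=> x y /(congr1 val) /= /f_inj h; apply: val_inj; apply: h; exact: fsvalP.
have g_surj (y : (f @` X)%fset) : exists x, g x == y.
  have /imfsetP[x /= xX yx] := fsvalP y.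
  by exists [` xX]%fset; rewrite -val_eqE /= yx.
pose g' y := xchoose (g_surj y).
have g'K : cancel g' g by move=> y; exact/eqP/(xchooseP (g_surj y)).
have gK : cancel g g' by move=> x; apply: g_inj; rewrite g'K.
apply: (betti_isomorphism gK g'K) => x y /=; apply: ee'; exact: fsvalP.
Qed.

End betti_of_points.

(** * The modulus of a complex number *)

Section complex_modulus.
Context {R : realType}.
Implicit Types (z w : R[i]) (x : R).

Lemma cReD z w : complex.Re (z + w) = complex.Re z + complex.Re w.
Proof. by case: z; case: w. Qed.
Lemma cImD z w : complex.Im (z + w) = complex.Im z + complex.Im w.
Proof. by case: z; case: w. Qed.
Lemma cReM z w : complex.Re (z * w) =
  complex.Re z * complex.Re w - complex.Im z * complex.Im w.
Proof. by case: z; case: w. Qed.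
Lemma cImM z w : complex.Im (z * w) =
  complex.Re z * complex.Im w + complex.Im z * complex.Re w.
Proof. by case: z; case: w. Qed.

Lemma Re_le_normc z : `|complex.Re z| <= normc z.
Proof.
case: z => a b /=; rewrite -sqrtr_sqr ler_wsqrtr // lerDl; exact: sqr_ge0.
Qed.
Lemma Im_le_normc z : `|complex.Im z| <= normc z.
Proof.
case: z => a b /=; rewrite -sqrtr_sqr ler_wsqrtr // lerDr; exact: sqr_ge0.
Qed.
Lemma normc_ge0 z : 0 <= normc z.
Proof. by case: z => a b /=; exact: sqrtr_ge0. Qed.
Lemma normc_real x : normc (real_complex R x) = `|x|.
Proof. by rewrite /= expr0n /= addr0 sqrtr_sqr. Qed.
Lemma normc_conj z : normc (conjc z) = normc z.
Proof. by case: z => a b /=; rewrite sqrrN. Qed.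
Lemma normcX z n : normc (z ^+ n) = normc z ^+ n.
Proof.
elim: n => [|n IHn]; first by rewrite !expr0 normc1.
by rewrite !exprS normcM IHn.
Qed.
Lemma normc_sum (I : Type) (r : seq I) (P : pred I) (F : I -> R[i]) :
  normc (\sum_(i <- r | P i) F i) <= \sum_(i <- r | P i) normc (F i).
Proof.
elim/big_rec2: _ => [|i y z _ h]; first by rewrite normc0.
by apply: le_trans (le_normcD _ _) _; rewrite lerD2l.
Qed.
Lemma normc_prod (I : Type) (r : seq I) (P : pred I) (F : I -> R[i]) :
  normc (\prod_(i <- r | P i) F i) = \prod_(i <- r | P i) normc (F i).
Proof. by elim/big_rec2: _ => [|i y z _ <-]; rewrite ?normc1 ?normcM. Qed.

End complex_modulus.

(** * Rips complexes of dense points in a convex set *)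

Section euclidean_plane.
Context {R : realType}.
Implicit Types (x y z w : R * R) (t : R).

Definition edist x y : R := Num.sqrt ((y.1 - x.1) ^+ 2 + (y.2 - x.2) ^+ 2).

Definition lerp t x y : R * R :=
  ((1 - t) * x.1 + t * y.1, (1 - t) * x.2 + t * y.2).

Lemma edist_normc x y : edist x y = normc (Complex (y.1 - x.1) (y.2 - x.2)).
Proof. by []. Qed.

Lemma edist_ge0 x y : 0 <= edist x y.
Proof. exact: sqrtr_ge0. Qed.

Lemma edistC x y : edist x y = edist y x.
Proof. by rewrite /edist -(opprB y.1) -(opprB y.2) !sqrrN. Qed.

Lemma edistxx x : edist x x = 0.
Proof. by rewrite /edist !subrr expr0n addr0 sqrtr0. Qed.

Lemma edist_sqr x y : edist x y ^+ 2 = (y.1 - x.1) ^+ 2 + (y.2 - x.2) ^+ 2.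
Proof. by rewrite sqr_sqrtr // addr_ge0 // sqr_ge0. Qed.

Lemma edist_triangle y x z : edist x z <= edist x y + edist y z.
Proof.
rewrite !edist_normc; apply: le_trans (le_normcD _ _).
rewrite le_eqVlt; apply/orP; left; apply/eqP; congr normc.
by apply/eqP; rewrite eq_complex /=; apply/andP; split; apply/eqP; ring.
Qed.

Lemma edist_lerp t w x y : 0 <= t -> t <= 1 ->
  edist w (lerp t x y) <= (1 - t) * edist w x + t * edist w y.
Proof.
move=> t0 t1; rewrite !edist_normc.
have -> : Complex ((lerp t x y).1 - w.1) ((lerp t x y).2 - w.2) =
    real_complex R (1 - t) * Complex (x.1 - w.1) (x.2 - w.2) +
    real_complex R t * Complex (y.1 - w.1) (y.2 - w.2).
  by apply/eqP; rewrite eq_complex /=; apply/andP; split; apply/eqP; ring.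
apply: le_trans (le_normcD _ _) _.
by rewrite !normcM !normc_real !ger0_norm // subr_ge0.
Qed.

(** Stewart's theorem; every estimate on the lens reduces to it. *)
Lemma edist_lerp_sqr t w x y : edist w (lerp t x y) ^+ 2 =
  (1 - t) * edist w x ^+ 2 + t * edist w y ^+ 2 - t * (1 - t) * edist x y ^+ 2.
Proof. by rewrite !edist_sqr /=; ring. Qed.

Lemma edist_eq0 x y : edist x y = 0 -> x = y.
Proof.
move=> /eqP; rewrite sqrtr_eq0 le_eqVlt ltNge addr_ge0 ?sqr_ge0 // orbF.
rewrite paddr_eq0 ?sqr_ge0 // !sqrf_eq0 !subr_eq0 => /andP[/eqP h1 /eqP h2].
by case: x y h1 h2 => [a b] [c d] /= -> ->.
Qed.

Lemma edist_le x y (r : R) : 0 <= r -> edist x y ^+ 2 <= r ^+ 2 -> edist x y <= r.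
Proof. by move=> r0; rewrite ler_sqr ?nnegrE ?edist_ge0. Qed.

End euclidean_plane.

Section dense_cloud.
Context {R : realType}.
Variables (V : finType) (p : V -> R * R) (r : R) (W : R * R -> Prop).
Hypothesis r0 : 0 < r.
Hypothesis W0 : W (0, 0).
Hypothesis W_convex : forall t x y, 0 <= t -> t <= 1 -> W x -> W y -> W (lerp t x y).
Hypothesis pW : forall v, W (p v).
Hypothesis W_dense : forall q, W q -> exists v, edist q (p v) <= r / 20.

Let e : rel V := fun x y => edist (p x) (p y) <= r.
Let norm (v : V) := edist (0, 0) (p v).

Lemma close_refl : reflexive e.
Proof. by move=> x; rewrite /e edistxx ltW. Qed.

Lemma close_sym : symmetric e.
Proof. by move=> x y; rewrite /e edistC. Qed.

Section lens.
Variables (S : {set V}) (x : V).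
Hypothesis xr : r / 2 < norm x.
Hypothesis x_max : forall z, z \in S -> norm z <= norm x.
Hypothesis S_inner : forall z, norm z < norm x -> z \in S.

Let t := (r / 2) / norm x.
Let q := lerp t (p x) (0, 0).

Let nx0 : 0 < norm x. Proof. by apply: lt_trans xr; rewrite divr_gt0. Qed.

Let t01 : 0 <= t /\ t <= 1.
Proof.
rewrite /t; split; first by rewrite ltW // !divr_gt0.
by rewrite ler_pdivrMr // mul1r ltW.
Qed.

Let tnx : t * norm x = r / 2.
Proof. by rewrite /t divfK // gt_eqF. Qed.

Let qnorm : edist (0, 0) q <= norm x - r / 2.
Proof.
have [t0 t1] := t01.
apply: le_trans (edist_lerp _ _ _ t0 t1) _.
by rewrite edistxx mulr0 addr0 mulrBl mul1r -/(norm x) tnx.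
Qed.

Let xq : edist (p x) q <= r / 2.
Proof.
have [t0 t1] := t01.
apply: le_trans (edist_lerp _ _ _ t0 t1) _.
by rewrite edistxx mulr0 add0r edistC -/(norm x) tnx.
Qed.

Let Wq : W q.
Proof. by have [t0 t1] := t01; exact: W_convex. Qed.

(** Stewart's theorem in the triangle formed by [w], [x] and the origin: [w]
    is no farther from the origin than [x] is. *)
Lemma lens_far w : w \in link e S x -> edist (p w) q ^+ 2 <= r ^+ 2 + (r / 2) ^+ 2.
Proof.
rewrite inE => /and3P[wS _ xw]; have [t0 t1] := t01.
rewrite edist_lerp_sqr.
have h1 : edist (p w) (p x) ^+ 2 <= r ^+ 2.
  by rewrite ler_sqr ?nnegrE ?edist_ge0 ?(ltW r0) // edistC; exact: xw.
have h2 : edist (p w) (0, 0) ^+ 2 <= norm x ^+ 2.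
  by rewrite ler_sqr ?nnegrE ?edist_ge0 // edistC; exact: x_max.
rewrite (edistC (p x)) -/(norm x) -tnx.
have g1 : (1 - t) * edist (p w) (p x) ^+ 2 <= (1 - t) * r ^+ 2.
  by apply: ler_wpM2l => //; rewrite subr_ge0.
have g2 := ler_wpM2l t0 h2.
have g3 : 0 <= t * r ^+ 2 by rewrite mulr_ge0 // sqr_ge0.
rewrite exprMn; lra.
Qed.

(** By Stewart's theorem in the triangle [w], [z], [q], a point [w] of the
    lens adjacent to [z] satisfies, in units where [r] is 1, |w - u|^2 <= 3/4
    + (1 + 1/4)/4 - (3/16) (19/20)^2 < (19/20)^2 for the point [u] at a
    quarter of the way from [z] to [q].  The slack of [r / 20] absorbs the
    replacement of [u] by a point of the cloud. *)
Lemma lens_dominated z : z \in link e S x -> r - r / 20 < edist q (p z) ->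
  exists z', [/\ z' \in link e S x, edist q (p z') < edist q (p z) &
    forall w, w \in link e S x -> e z w -> e z' w].
Proof.
move=> zL zq; have := zL; rewrite inE => /and3P[zS zx xz].
(* [u] is at a quarter of the way from [z] to [q]. *)
have e0 : 0 <= 4^-1 :> R by rewrite invr_ge0.
have e1 : 4^-1 <= 1 :> R by rewrite invf_le1 // ler1n.
pose u := lerp 4^-1 (p z) q.
have [z' z'u] := W_dense (W_convex e0 e1 (pW z) Wq).
have nz' : norm z' < norm x.
  have := edist_lerp (0, 0) (p z) q e0 e1.
  have := edist_triangle u (0, 0) (p z'); have := x_max zS.
  have := qnorm; have := z'u; rewrite -/u /norm; have := r0; lra.
exists z'; split.
- rewrite inE S_inner //=; apply/andP; split.
    by apply: contraTneq nz' => ->; rewrite ltxx.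
  have := edist_lerp (p x) (p z) q e0 e1; have := xq; have : edist (p x) (p z) <= r := xz.
  have := edist_triangle u (p x) (p z'); have := z'u; rewrite -/u /e; have := r0; lra.
- have := edist_lerp q (p z) q e0 e1; rewrite edistxx.
  have := edist_triangle u q (p z'); have := z'u; rewrite -/u; have := r0; lra.
move=> w wL zw.
have wu : edist (p w) u <= r - r / 20.
  apply: edist_le; first by have := r0; lra.
  rewrite edist_lerp_sqr.
  have h1 : edist (p w) (p z) ^+ 2 <= r ^+ 2.
    by rewrite ler_sqr ?nnegrE ?edist_ge0 ?(ltW r0) // edistC; exact: zw.
  have h2 := lens_far wL.
  have h3 : (r - r / 20) ^+ 2 <= edist (p z) q ^+ 2.
    rewrite ler_sqr ?nnegrE ?edist_ge0 //; last by have := r0; lra.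
    by rewrite edistC ltW.
  have := sqr_ge0 r; move: h1 h2 h3; rewrite !expr2; lra.
rewrite /e edistC; have := edist_triangle u (p w) (p z'); have := z'u; rewrite -/u; lra.
Qed.

(** The points of the link are removed by decreasing distance to [q]: the
    dominating point is always closer to [q], so it is still present.  What
    remains is a cone over a point near [q]. *)
Lemma dismantlable_lens : exists2 y, y \in link e S x & dismantlable e (link e S x).
Proof.
have [y yq] := W_dense Wq.
have yL : y \in link e S x.
  have ny : norm y < norm x.
    have := edist_triangle q (0, 0) (p y); have := qnorm; rewrite /norm; have := r0; lra.
  rewrite inE S_inner //=; apply/andP; split.
    by apply: contraTneq ny => ->; rewrite ltxx.
  have := edist_triangle q (p x) (p y); have := xq; rewrite /e; have := r0; lra.
exists y => //.
suff : forall n (T : {set V}), #|T| = n -> y \in T -> T \subset link e S x ->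
    (forall z w, z \in link e S x -> w \in T -> edist q (p z) < edist q (p w) -> z \in T) ->
    dismantlable e T.
  by move=> /(_ _ _ erefl yL (subxx _)); apply=> z w ->.
elim=> [T /eqP|n IHn T cT yT /fintype.subsetP TL Tin].
  by rewrite cards_eq0 => /eqP ->; rewrite inE.
have [z zT zmax] : exists2 z, z \in T & forall w, w \in T -> edist q (p w) <= edist q (p z).
  by case: (arg_maxP (fun v => edist q (p v)) yT) => z zT h; exists z.
have [zq|zq] := leP (edist q (p z)) (r - r / 20).
  apply: (@dismantlable_cone _ _ _ y) => // w wT.
  have := edist_triangle q (p y) (p w); have := zmax w wT; rewrite /e (edistC (p y) q); lra.
have [z' [z'L z'q dom]] := lens_dominated (TL z zT) zq.
apply: (@dismantlable_dominated _ _ close_refl close_sym _ z z') => //.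
- exact: Tin z'q.
- by apply: contraTneq z'q => ->; rewrite ltxx.
- by move=> w /TL; exact: dom.
apply: IHn.
- by apply/eqP; rewrite -eqSS -cT (cardsD1 z T) zT.
- rewrite !inE yT andbT; apply: contraTneq zq => <-.
  by rewrite -leNgt; have := r0; lra.
- by apply/fintype.subsetP => w; rewrite !inE => /andP[_ /TL]; rewrite inE.
- move=> v w vL; rewrite !inE => /andP[wz wT] vw.
  rewrite (Tin _ _ vL wT vw) andbT; apply: contraTneq vw => ->.
  by rewrite -leNgt zmax.
Qed.

End lens.

(** The farthest point from the origin is removed repeatedly; density is only
    ever used for points of the lens, all of which are closer to the origin
    than the point being removed, so it is not destroyed by earlier removals.
    *)
Lemma dismantlable_dense : dismantlable e [set: V].
Proof.
have [v0 _] := W_dense W0.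
suff : forall n (S : {set V}), #|S| = n -> S != finset.set0 ->
    (forall z w, w \in S -> norm z < norm w -> z \in S) -> dismantlable e S.
  apply=> [//||z w _ _]; last by rewrite inE.
  by apply/set0Pn; exists v0; rewrite inE.
elim=> [S /eqP|n IHn S cS /set0Pn[v vS] Sin].
  by rewrite cards_eq0 => ->.
have [x xS xmax] : exists2 x, x \in S & forall z, z \in S -> norm z <= norm x.
  by case: (arg_maxP norm vS) => x xS h; exists x.
have [xr|xr] := leP (norm x) (r / 2).
  apply: (@dismantlable_cone _ _ _ x) => // z zS.
  have := edist_triangle (0, 0) (p x) (p z); have := xmax z zS.
  rewrite /e (edistC (p x) (0, 0)) /norm in xr *; lra.
have Sinx z : norm z < norm x -> z \in S by exact: Sin.
have [y yL dL] := dismantlable_lens xr xmax Sinx.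
apply: (dismantlable_remove xS dL); apply: IHn.
- by apply/eqP; rewrite -eqSS -cS (cardsD1 x S) xS.
- apply/set0Pn; exists y; move: yL; rewrite !inE => /and3P[-> -> _].
  by [].
- move=> z w; rewrite !inE => /andP[wx wS] zw.
  rewrite (Sin _ _ wS zw) andbT; apply: contraTneq zw => ->.
  by rewrite -leNgt xmax.
Qed.

End dense_cloud.

Section rips_flag.
Context {R : realType}.

Definition close (eps : R) (x y : R * R) : bool := edist x y <= eps.

(** The midpoint of the two centres is a common point whenever there is one.
    *)
Lemma euclidean_balls_meet (x y : R * R) (eps : R) :
  `[< (euclidean_ball x (eps / 2) `&` euclidean_ball y (eps / 2) !=set0)%classic >] =
  close eps x y.
Proof.
apply/asboolP/idP => [[u [ux uy]]|xy].
  have := edist_triangle u x y; rewrite (edistC u).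
  move: ux uy; rewrite /euclidean_ball /= -!/(edist _ _) /close; lra.
have h0 : 0 <= 2^-1 :> R by rewrite invr_ge0.
have h1 : 2^-1 <= 1 :> R by rewrite invf_le1 // ler1n.
exists (lerp 2^-1 x y); split; rewrite /euclidean_ball /= -!/(edist _ (lerp 2^-1 x y)).
  have := edist_lerp x x y h0 h1; rewrite edistxx; move: xy; rewrite /close; lra.
have := edist_lerp y x y h0 h1; rewrite edistxx (edistC y x); move: xy; rewrite /close; lra.
Qed.

Lemma rips_flag (X : {fset plane R}) (eps : R) :
  rips X eps = flag_complex (fun x y : X => close eps (val x) (val y)).
Proof.
apply/setP => s; rewrite !inE; congr (_ && _).
apply: eq_forallb => x; congr (_ ==> _); apply: eq_forallb => y; congr (_ ==> _).
exact: euclidean_balls_meet.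
Qed.

End rips_flag.

Local Open Scope classical_set_scope.
Local Open Scope ring_scope.

(** * Vanishing of homology is an event *)

Section grid.
Context {R : realType}.
Local Notation plane := (plane R).

Definition grid_cell (j : nat) (x : plane) : int * int :=
  (Num.floor (j.+1%:R * x.1), Num.floor (j.+1%:R * x.2)).

Definition grid_point (c : int * int) : R * R := (c.1%:~R, c.2%:~R).

(** Distances are measured in the grid of mesh 1, after scaling by [j + 1].
    Rounding moves each point by less than 2, and the slack 4 keeps all pairs
    at distance exactly [eps] adjacent; pairs at a larger distance cease to be
    adjacent when [j] is large. *)
Definition cells_close (j : nat) (eps : R) (c c' : int * int) : bool :=
  close (j.+1%:R * eps + 4) (grid_point c) (grid_point c').

Lemma edist_scale (j : nat) (x y : R * R) :
  edist (j.+1%:R * x.1, j.+1%:R * x.2) (j.+1%:R * y.1, j.+1%:R * y.2) =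
  j.+1%:R * edist x y.
Proof.
rewrite /edist /= -!mulrBr !exprMn -mulrDr sqrtrM ?sqr_ge0 //.
by rewrite sqrtr_sqr ger0_norm.
Qed.

Lemma grid_cell_near (j : nat) (x : plane) :
  edist (j.+1%:R * x.1, j.+1%:R * x.2) (grid_point (grid_cell j x)) <= 2.
Proof.
apply: edist_le => //; rewrite edist_sqr /=.
have unit_sqr (y : R) : ((Num.floor y)%:~R - y) ^+ 2 <= 1.
  have /andP[h1 h2] := floor_itv y; rewrite intrD in h2.
  have := mulr_ge0 (_ : 0 <= y - (Num.floor y)%:~R) (_ : 0 <= (Num.floor y)%:~R + 1 - y).
  rewrite expr2; set f := (Num.floor y)%:~R in h1 h2 *.
  by move=> /(_ ltac:(lra) ltac:(lra)); lra.
have := unit_sqr (j.+1%:R * x.1); have := unit_sqr (j.+1%:R * x.2); lra.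
Qed.

Lemma grid_cell_edist (j : nat) (x y : plane) :
  `|edist (grid_point (grid_cell j x)) (grid_point (grid_cell j y)) -
    j.+1%:R * edist x y| <= 4.
Proof.
set c := grid_point _; set c' := grid_point _.
set x' := (j.+1%:R * x.1, j.+1%:R * x.2); set y' := (j.+1%:R * y.1, j.+1%:R * y.2).
have hx : edist x' c <= 2 := grid_cell_near j x.
have hy : edist y' c' <= 2 := grid_cell_near j y.
rewrite -edist_scale -/x' -/y' ler_norml; apply/andP; split.
  have := edist_triangle c x' y'; have := edist_triangle c' c y'.
  rewrite (edistC c' y'); lra.
have := edist_triangle x' c c'; have := edist_triangle y' x' c'.
rewrite (edistC c x'); lra.
Qed.

Lemma measurable_grid_cell (j : nat) (c : int * int) :
  measurable (grid_cell j @^-1` [set c]).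
Proof.
have mfl (i : int) (h : plane -> measurableTypeR R) : measurable_fun setT h ->
    measurable [set x | Num.floor (j.+1%:R * h x) = i].
  move=> mh.
  have -> : [set x | Num.floor (j.+1%:R * h x) = i] =
      (fun x => j.+1%:R * h x) @^-1` `[i%:~R, (i + 1)%:~R[.
    apply/seteqP; split => x /=; rewrite in_itv /=.
      by move=> <-; exact: floor_itv.
    by move=> h'; apply: floor_def.
  rewrite -[X in measurable X]setTI.
  have m1 : measurable_fun setT (fun x => j.+1%:R * h x) by exact: measurable_funM.
  exact: m1.
have -> : grid_cell j @^-1` [set c] =
    [set x | Num.floor (j.+1%:R * x.1) = c.1] `&` [set x | Num.floor (j.+1%:R * x.2) = c.2].
  by apply/seteqP; split => x /=; rewrite /grid_cell; [move=> <-|case: c => a b /= [-> ->]].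
apply: measurableI; apply: mfl; [exact: measurable_fst|exact: measurable_snd].
Qed.

End grid.

Section betti_event.
Context {R : realType}.
Local Notation plane := (plane R).
Context {d : measure_display} {Omega : measurableType d}.
Variables (Phi : Omega -> set plane) (W : set plane).
Hypothesis finPhi : forall w, finite_set (Phi w `&` W).
Hypothesis mPhi : forall B, measurable B -> measurable_fun setT (point_count Phi B).
Hypothesis mW : measurable W.
Variables (k : nat) (eps : R).

Let X w : {fset plane} := fset_set (Phi w `&` W).
Let occupied j w : {fset int * int} := (grid_cell j @` X w)%fset.

Let grid_event j : set Omega :=
  [set w | betti k (point_graph (@cells_close R j eps) (occupied j w)) = 0%N].

Lemma measurable_hit (B : set plane) : measurable B ->
  measurable [set w | Phi w `&` B !=set0].
Proof.
move=> mB; have mc := mPhi mB.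
have -> : [set w | Phi w `&` B !=set0] = point_count Phi B @^-1` (~` [set 0%E]).
  apply/seteqP; split => w /=; rewrite /point_count /counting.
    move=> [x hx]; case: asboolP => // fB.
    move=> [] /eqP; rewrite pnatr_eq0 cardfs_eq0 => /eqP h.
    have : x \in fset_set (Phi w `&` B) by rewrite in_fset_set // mem_set.
    by rewrite h in_fset0.
  move=> h; apply/set0P; apply/eqP => h0; apply: h.
  by rewrite h0 asboolT // fset_set0 cardfs0.
rewrite -[X in measurable X]setTI; apply: mc => //.
by apply: measurableC; exact: emeasurable_set1.
Qed.

Let measurable_occupied j S : measurable [set w | occupied j w = S].
Proof.
pose A (c : int * int) := [set w | (c \in occupied j w) = (c \in S)].
have -> : [set w | occupied j w = S] = \bigcap_c A c.
  apply/seteqP; split => w /=; first by move=> wS c _; rewrite /A /= wS.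
  by move=> h; apply/fsetP => c; exact: h.
have mA c : measurable (A c).
  pose H := [set w | Phi w `&` (W `&` grid_cell j @^-1` [set c]) !=set0].
  have mH : measurable H.
    by apply: measurable_hit; apply: measurableI => //; exact: measurable_grid_cell.
  have HE w : H w <-> c \in occupied j w.
    split=> [[x [Px [Wx /= xc]]]|/imfsetP[x /= xX cE]].
      apply/imfsetP; exists x => //=; rewrite in_fset_set //; exact/mem_set.
    exists x; move: xX; rewrite in_fset_set // => /set_mem[Px Wx].
    by split; [|split; [|rewrite /= cE]].
  have [cS|cS] := boolP (c \in S).
    rewrite (_ : A c = H) //; apply/seteqP; split => w; rewrite /A /= cS.
      by move=> /HE.
    by move=> /HE ->.
  rewrite (_ : A c = ~` H); first exact: measurableC.
  apply/seteqP; split => w; rewrite /A /= (negbTE cS).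
    by move=> h /HE; rewrite h.
  by move=> h; apply/negP => /HE.
have -> : \bigcap_c A c = ~` (\bigcup_c ~` A c).
  by rewrite setC_bigcup; apply: eq_bigcapr => c _; rewrite setCK.
apply: measurableC; apply: countable_bigcupT_measurable => [|c].
  exact: countableP.
exact: measurableC.
Qed.

Let measurable_grid_event j : measurable (grid_event j).
Proof.
pose good := [set S : {fset int * int} | betti k (point_graph (@cells_close R j eps) S) = 0%N].
have -> : grid_event j = \bigcup_S (if `[< good S >] then [set w | occupied j w = S] else set0).
  apply/seteqP; split => w /=.
    by move=> h; exists (occupied j w) => //=; rewrite asboolT.
  by move=> [S _]; case: asboolP => // gS /= oS; move: gS; rewrite -oS.
apply: countable_bigcupT_measurable => [|S]; first exact: countableP.
by case: ifP.
Qed.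

Let eventually_grid w : \forall j \near \oo,
  betti k (rips (X w) eps) =
  betti k (point_graph (@cells_close R j eps) (occupied j w)).
Proof.
have pair (x y : plane) : \forall j \near \oo,
    (x <> y -> grid_cell j x <> grid_cell j y) /\
    close eps x y = cells_close j eps (grid_cell j x) (grid_cell j y).
  have large (K t : R) : 0 < t -> \forall j \near \oo, K < j.+1%:R * t.
    move=> t0; near=> j; rewrite -ltr_pdivrMr //.
    apply: (@lt_trans _ _ j%:R); last by rewrite ltr_nat.
    by near: j; exact: nbhs_infty_gtr.
  have nE j := grid_cell_edist j x y.
  apply: filterI.
    have [->|xy] := pselect (x = y); first by near=> j; case.
    have D0 : 0 < edist x y.
      rewrite lt_def edist_ge0 andbT; apply/eqP => /edist_eq0; exact: xy.
    near=> j; move=> _ cc; have := nE j; rewrite cc edistxx sub0r normrN.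
    rewrite ger0_norm ?mulr_ge0 ?edist_ge0 // leNgt; apply/negP/negPn.
    by near: j; exact: large.
  rewrite /close /cells_close /close; have [xy|xy] := leP (edist x y) eps.
    near=> j; apply/esym; have := nE j; rewrite ler_norml => /andP[_].
    have : j.+1%:R * edist x y <= j.+1%:R * eps by rewrite ler_wpM2l.
    lra.
  near=> j; apply/esym/negbTE; rewrite -ltNge.
  have : 8 < j.+1%:R * (edist x y - eps) by near: j; apply: large; rewrite subr_gt0.
  have := nE j; rewrite ler_norml => /andP[+ _]; lra.
have all : \forall j \near \oo, forall x y, x \in X w -> y \in X w ->
    (x <> y -> grid_cell j x <> grid_cell j y) /\
    close eps x y = cells_close j eps (grid_cell j x) (grid_cell j y).
  have : \forall j \near \oo, forall x : X w, forall y : X w,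
      (val x <> val y -> grid_cell j (val x) <> grid_cell j (val y)) /\
      close eps (val x) (val y) = cells_close j eps (grid_cell j (val x)) (grid_cell j (val y)).
    by apply: filter_forall => x; apply: filter_forall => y; exact: pair.
  by apply: filterS => j h x y xX yX; exact: (h [` xX]%fset [` yX]%fset).
apply: filterS all => j h; rewrite rips_flag; apply: betti_point_graph_image.
  move=> x y xX yX xy; have [h1 _] := h x y xX yX.
  by apply: contrapT => /h1.
by move=> x y xX yX; have [_] := h x y xX yX.
Unshelve. all: by end_near.
Qed.

(** For a fixed realization the cells of a fine enough grid separate the
    points and reproduce their adjacency relation, so the event is the lower
    limit of events that depend only on which cells are occupied. *)
Lemma measurable_betti_event : measurable [set w | betti k (rips (X w) eps) = 0%N].
Proof.
have -> : [set w | betti k (rips (X w) eps) = 0%N] =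
    \bigcup_J \bigcap_(j >= J) grid_event j.
  apply/seteqP; split => w /=.
    have [J _ h] := eventually_grid w; move=> b0; exists J => // j Jj.
    by rewrite /grid_event /= -h.
  move=> [J _ hJ]; have [J' _ h] := eventually_grid w.
  rewrite (h (maxn J J')) /=; last exact: leq_maxr.
  by apply: hJ; exact: leq_maxl.
apply: bigcup_measurable => J _; apply: bigcap_measurableType => j _.
exact: measurable_grid_event.
Qed.

End betti_event.

(** * Area preserving maps of the plane *)

Section plane_isometries.
Context {R : realType}.
Local Notation plane := (plane R).
Local Notation mu := (@lebesgue_measure R).
Local Notation lambda2 := (@plane_lebesgue R).

Lemma measurable_addr (a : R) : measurable_fun setT ((fun x => x + a) : measurableTypeR R -> measurableTypeR R).
Proof. exact: measurable_funD. Qed.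

Lemma integral_translation (f : measurableTypeR R -> \bar R) (a : R) :
  measurable_fun setT f -> (forall x, 0 <= f x)%E ->
  (\int[mu]_x f (x + a)%R = \int[mu]_x f x)%E.
Proof.
move=> mf f0; pose phi := ((fun x => x + a) : measurableTypeR R -> measurableTypeR R).
have mphi : measurable_fun setT phi by exact: measurable_addr.
transitivity (\int[pushforward mu phi]_(x in setT) f x)%E.
  by rewrite (ge0_integral_pushforward mphi).
have mphi_mixin := isMeasurableFun.Build _ _ _ _ _ mphi.
pose phi' : {mfun _ >-> _} := HB.pack phi mphi_mixin.
apply: (@eq_measure_integral _ _ _ _ mu (pushforward mu phi')) => A mA _.
apply/esym/lebesgue_measure_unique => //= _ [[b c]] _ <-.
rewrite /pushforward (_ : _ @^-1` _ = `]b - a, c - a]%classic).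
  rewrite !lebesgue_measure_itv /= !lte_fin ltrD2r.
  by rewrite !EFinB; case: ifP => // _; rewrite -!EFinB; congr (_%:E); ring.
by apply/seteqP; split => x /=; rewrite !in_itv /= /phi ltrBlDr lerBrDr.
Qed.

Definition area_preserving (g : plane -> plane) : Prop :=
  measurable_fun setT g /\
  forall f : plane -> \bar R, measurable_fun setT f ->
    (\int[lambda2]_z f (g z) = \int[lambda2]_z f z)%E.

(** Integrals are differences of integrals of positive and negative parts. *)
Lemma area_preserving_ge0 (g : plane -> plane) : measurable_fun setT g ->
  (forall f : plane -> \bar R, measurable_fun setT f -> (forall z, 0 <= f z)%E ->
    (\int[lambda2]_z f (g z) = \int[lambda2]_z f z)%E) ->
  area_preserving g.
Proof.
move=> mg h; split=> // f mf; rewrite integralE [RHS]integralE.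
congr (_ - _)%E.
  rewrite -(h (f^\+)%E (measurable_funepos mf)) => [|z]; last exact: funepos_ge0.
  by apply: eq_integral => z _; rewrite !funeposE.
rewrite -(h (f^\-)%E (measurable_funeneg mf)) => [|z]; last exact: funeneg_ge0.
by apply: eq_integral => z _; rewrite !funenegE.
Qed.

Lemma area_preserving_comp (g1 g2 : plane -> plane) :
  area_preserving g1 -> area_preserving g2 -> area_preserving (g1 \o g2).
Proof.
move=> [m1 h1] [m2 h2]; split; first exact: measurableT_comp.
move=> f mf; rewrite -[RHS]h1 // -[RHS]h2 //.
exact: measurableT_comp.
Qed.

Lemma area_preserving_shear1 (h : measurableTypeR R -> measurableTypeR R) : measurable_fun setT h ->
  area_preserving (fun z : plane => (z.1 + h z.2, z.2) : plane).
Proof.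
move=> mh.
have mg : measurable_fun setT (fun z : plane => (z.1 + h z.2, z.2) : plane).
  apply/measurable_fun_pairP; split; last exact: measurable_snd.
  apply: measurable_funD; first exact: measurable_fst.
  apply: measurableT_comp => //; exact: measurable_snd.
apply: area_preserving_ge0 => // f mf f0.
rewrite /plane_lebesgue !fubini_tonelli2 //; last exact: measurableT_comp.
apply: eq_integral => y _; rewrite /fubini_G /=.
rewrite (integral_translation (f := fun x => f (x, y))) //.
apply: measurableT_comp => //; exact: pair2_measurable.
Qed.

Lemma area_preserving_shear2 (h : measurableTypeR R -> measurableTypeR R) : measurable_fun setT h ->
  area_preserving (fun z : plane => (z.1, z.2 + h z.1) : plane).
Proof.
move=> mh.
have mg : measurable_fun setT (fun z : plane => (z.1, z.2 + h z.1) : plane).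
  apply/measurable_fun_pairP; split; first exact: measurable_fst.
  apply: measurable_funD; first exact: measurable_snd.
  apply: measurableT_comp => //; exact: measurable_fst.
apply: area_preserving_ge0 => // f mf f0.
rewrite /plane_lebesgue !fubini_tonelli1 //; last exact: measurableT_comp.
apply: eq_integral => x _; rewrite /fubini_F /=.
rewrite (integral_translation (f := fun y => f (x, y))) //.
apply: measurableT_comp => //; exact: pair1_measurable.
Qed.

Lemma area_preserving_translation (a : plane) :
  area_preserving (fun z : plane => (z.1 + a.1, z.2 + a.2) : plane).
Proof.
apply: (area_preserving_comp (g2 := fun z : plane => (z.1, z.2 + a.2) : plane)
  (g1 := fun z : plane => (z.1 + a.1, z.2) : plane)).
  exact: (area_preserving_shear1 (h := cst a.1)).
exact: (area_preserving_shear2 (h := cst a.2)).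
Qed.

(** A rotation other than the half-turn is a product of three shears, and
    shears preserve area by Fubini's theorem and translation invariance on the
    line. *)
Lemma area_preserving_rotation (c s : R) : c ^+ 2 + s ^+ 2 = 1 -> 1 + c != 0 ->
  area_preserving (fun z : plane => (c * z.1 - s * z.2, s * z.1 + c * z.2) : plane).
Proof.
move=> cs c1; pose t := - s / (1 + c).
have st : area_preserving (fun z : plane => (z.1 + t * z.2, z.2) : plane).
  apply: (area_preserving_shear1 (h := fun y => t * y)).
  exact: mulrl_measurable.
have ss : area_preserving (fun z : plane => (z.1, z.2 + s * z.1) : plane).
  apply: (area_preserving_shear2 (h := fun y => s * y)).
  exact: mulrl_measurable.
have := area_preserving_comp st (area_preserving_comp ss st).
congr area_preserving; apply/funext => -[x y] /=.
have E1 : 1 + t * s = c.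
  have s2 : s ^+ 2 = (1 - c) * (1 + c) by apply: (addrI (c ^+ 2)); rewrite cs; ring.
  rewrite [t * s](_ : _ = - (s ^+ 2) / (1 + c)); last by rewrite /t; ring.
  by rewrite s2; field.
have E2 : t + t * (1 + s * t) = - s.
  rewrite (mulrC s) E1.
  rewrite [t + _](_ : _ = t * (1 + c)); last by ring.
  by rewrite /t mulfVK.
congr pair; last by rewrite -E1; ring.
transitivity ((1 + t * s) * x + (t + t * (1 + s * t)) * y); first ring.
by rewrite E1 E2; ring.
Qed.

End plane_isometries.


(** * Gaussian moments *)

Section gaussian_moments.
Context {R : realType}.
Local Notation plane := (plane R).
Local Notation mu := (@lebesgue_measure R).
Local Notation lambda2 := (@plane_lebesgue R).

Definition sqnorm (z : plane) : R := z.1 ^+ 2 + z.2 ^+ 2.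

Lemma sqnorm_ge0 z : 0 <= sqnorm z.
Proof. by rewrite addr_ge0 // sqr_ge0. Qed.

Lemma measurable_sqnorm : measurable_fun setT sqnorm.
Proof.
apply: measurable_funD; apply: measurable_funX; [exact: measurable_fst|exact: measurable_snd].
Qed.

Lemma gauss_integral_line (a : R) : 0 < a ->
  (\int[mu]_x (expR (- a * x ^+ 2))%:E = (Num.sqrt (pi / a))%:E)%E.
Proof.
move=> a0; pose s := Num.sqrt (1 / (2 * a)).
have s0 : s != 0 by rewrite gt_eqF // sqrtr_gt0 divr_gt0 // mulr_gt0.
have s2 : s ^+ 2 = 1 / (2 * a) by rewrite sqr_sqrtr // divr_ge0 // mulr_ge0 // ltW.
have p0 := normal_peak_gt0 s0.
have := @integral_normal_pdf R 0 s.
rewrite normal_pdfE //.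
under eq_integral do rewrite EFinM.
rewrite ge0_integralZl //=; last 3 first.
- by apply/measurable_EFinP; exact: measurable_normal_fun.
- by move=> x _; rewrite lee_fin normal_fun_ge0.
- by rewrite lee_fin ltW.
have -> : (\int[mu]_x (normal_fun 0 s x)%:E = \int[mu]_x (expR (- a * x ^+ 2))%:E)%E.
  apply: eq_integral => x _; rewrite /normal_fun subr0 s2; congr ((expR _)%:E).
  by rewrite mulr2n; field; rewrite gt_eqF.
set I := (X in (_ * X)%E = _) => h.
have : (((normal_peak s)^-1)%:E * ((normal_peak s)%:E * I) = ((normal_peak s)^-1)%:E)%E.
  by rewrite h mule1.
rewrite muleA -EFinM mulVf ?gt_eqF // mul1e => hI; transitivity I => //; rewrite hI.
rewrite /normal_peak invrK; congr ((Num.sqrt _)%:E).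
by rewrite s2; field; rewrite gt_eqF.
Qed.

(** By convexity. *)
Lemma exprS_ge_tangent (n : nat) (x y : R) : 0 <= x -> 0 <= y ->
  y ^+ n.+1 + n.+1%:R * (x - y) * y ^+ n <= x ^+ n.+1.
Proof.
move=> x0 y0; elim: n => [|n IHn]; first by rewrite !expr1 expr0; lra.
rewrite [leRHS]exprS; apply: le_trans (ler_wpM2l x0 IHn).
rewrite -subr_ge0 [leRHS](_ : _ = n.+1%:R * (x - y) ^+ 2 * y ^+ n).
  apply: mulr_ge0; last exact: exprn_ge0.
  by apply: mulr_ge0; [exact: ler0n|exact: sqr_ge0].
by rewrite -[n.+2%:R]natr1 !exprS; ring.
Qed.

Lemma measurable_sqnorm_gauss (j : nat) (a : R) :
  measurable_fun setT (fun z : plane => sqnorm z ^+ j * expR (- a * sqnorm z)).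
Proof.
apply: measurable_funM; first by apply: measurable_funX; exact: measurable_sqnorm.
apply: measurableT_comp => //; apply: measurable_funM => //.
exact: measurable_sqnorm.
Qed.

Lemma gauss_integral_plane (a : R) : 0 < a ->
  (\int[lambda2]_z (expR (- a * sqnorm z))%:E = (pi / a)%:E)%E.
Proof.
move=> a0; rewrite /plane_lebesgue fubini_tonelli1 /=; last first.
- by move=> z; rewrite lee_fin expR_ge0.
- apply/measurable_EFinP; have := measurable_sqnorm_gauss 0 a.
  by under eq_fun do rewrite expr0 mul1r.
rewrite /fubini_F.
transitivity (\int[mu]_x ((Num.sqrt (pi / a))%:E * (expR (- a * x ^+ 2))%:E))%E.
  apply: eq_integral => x _.
  under eq_integral do rewrite /sqnorm /= mulrDr expRD EFinM.
  rewrite ge0_integralZl //= ?lee_fin ?expR_ge0 //; first last.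
  - apply/measurable_EFinP; apply: measurableT_comp => //; apply: measurable_funM => //.
  by rewrite (gauss_integral_line a0) muleC.
rewrite ge0_integralZl //= ?lee_fin ?sqrtr_ge0 //; first last.
- apply/measurable_EFinP; apply: measurableT_comp => //; apply: measurable_funM => //.
rewrite (gauss_integral_line a0) -EFinM -expr2 sqr_sqrtr //.
by rewrite divr_ge0 ?pi_ge0 // ltW.
Qed.

Lemma gauss_increment (s a b : R) (j : nat) : 0 <= s ->
  (b - a) * (s ^+ j.+1 * expR (- b * s)) <=
  s ^+ j * expR (- a * s) - s ^+ j * expR (- b * s).
Proof.
move=> s0; rewrite -mulrBr exprSr -!mulrA mulrCA ler_wpM2l ?exprn_ge0 //.
rewrite [expR (- a * s)](_ : _ = expR ((b - a) * s) * expR (- b * s)); last first.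
  by rewrite -expRD; congr expR; ring.
rewrite -[X in _ <= _ - X]mul1r -mulrBl mulrA ler_wpM2r ?expR_ge0 //.
by rewrite lerBrDl expR_ge1Dx.
Qed.

(** Differentiating the moment of order [j] in [a] gives minus the moment of
    order [j + 1].  By convexity of the exponential the latter is squeezed
    between difference quotients of the former, so no differentiation under
    the integral is needed. *)
Lemma gauss_moment (j : nat) (a : R) : 0 < a ->
  (\int[lambda2]_z (sqnorm z ^+ j * expR (- a * sqnorm z))%:E =
   (pi * j`!%:R / a ^+ j.+1)%:E)%E.
Proof.
elim: j a => [|j IHj] a a0.
  under eq_integral do rewrite expr0 mul1r.
  by rewrite gauss_integral_plane // fact0 mulr1 expr1.
pose F j a := (\int[lambda2]_z (sqnorm z ^+ j * expR (- a * sqnorm z))%:E)%E.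
have F0 i (b : R) (z : plane) : (0%:E <= (sqnorm z ^+ i * expR (- b * sqnorm z))%:E)%E.
  by rewrite lee_fin mulr_ge0 ?expR_ge0 // exprn_ge0 // sqnorm_ge0.
have mF i (b : R) : measurable_fun setT
    (fun z : plane => (sqnorm z ^+ i * expR (- b * sqnorm z))%:E).
  by have /measurable_EFinP := measurable_sqnorm_gauss i b.
have key b c : b <= c -> (F j c + (c - b)%:E * F j.+1 c <= F j b)%E.
  move=> bc; rewrite /F -ge0_integralZl //; last by rewrite lee_fin subr_ge0.
  rewrite -ge0_integralD //; last 2 first.
  - by move=> z _; rewrite mule_ge0 // lee_fin subr_ge0.
  - exact: emeasurable_funM.
  apply: ge0_le_integral => //.
  - by move=> z _; rewrite adde_ge0 // mule_ge0 // lee_fin subr_ge0.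
  - by apply: emeasurable_funD => //; exact: emeasurable_funM.
  - move=> z _; rewrite -EFinM -EFinD lee_fin -lerBrDl.
    exact: gauss_increment (sqnorm_ge0 z).
have key' b c : b <= c -> (F j b <= F j c + (c - b)%:E * F j.+1 b)%E.
  move=> bc; rewrite /F -ge0_integralZl //; last by rewrite lee_fin subr_ge0.
  rewrite -ge0_integralD //; last 2 first.
  - by move=> z _; rewrite mule_ge0 // lee_fin subr_ge0.
  - exact: emeasurable_funM.
  apply: ge0_le_integral => //.
  - by apply: emeasurable_funD => //; exact: emeasurable_funM.
  - move=> z _; rewrite -EFinM -EFinD lee_fin -lerBlDl.
    have := gauss_increment c b j (sqnorm_ge0 z); rewrite -[b - c]opprB mulNr => h.
    lra.
have Jfin : F j.+1 a \is a fin_num.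
  have a2 : 0 < a / 2 by rewrite divr_gt0.
  have a2a : a / 2 <= a by lra.
  have := key _ _ a2a.
  rewrite {1 3}/F !IHj //.
  have : (0 <= F j.+1 a)%E by apply: integral_ge0.
  case: (F j.+1 a) => [//| |//] _.
  by rewrite gt0_muley ?lte_fin ?subr_gt0; [rewrite addey|lra].
rewrite -/(F _ _) -(fineK Jfin); congr (_%:E).
set J := fine (F j.+1 a); pose c : R := pi * j`!%:R.
have c0 : 0 <= c by rewrite mulr_ge0 ?pi_ge0.
pose x := a^-1; have x0 : 0 < x by rewrite invr_gt0.
have aE : a = x^-1 by rewrite invrK.
clearbody x.
(* In terms of the inverse parameters [x] and [y], difference quotients to the
   right of [a] bound the moment from below, those to the left from above. *)
have lower y : 0 < y -> y < x -> c * j.+1%:R * x * y ^+ j.+1 <= J.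
  move=> y0 yx; have yV : a <= y^-1 by rewrite aE lef_pV2 ?posrE // ltW.
  have := key' _ _ yV; rewrite -(fineK Jfin) -/J /F !IHj ?invr_gt0 // -/c.
  rewrite -EFinM -EFinD lee_fin {1 2}aE !exprVn !invrK => h.
  have T := exprS_ge_tangent j (ltW x0) (ltW y0).
  have {}h : c * (x ^+ j.+1 - y ^+ j.+1) <= (y^-1 - x^-1) * J by lra.
  have h2 : c * (j.+1%:R * (x - y) * y ^+ j) <= (y^-1 - x^-1) * J.
    apply: le_trans h; apply: ler_wpM2l => //. rewrite lerBrDl. exact: T.
  have E : (y^-1 - x^-1) * J = (x - y) / (x * y) * J.
    by congr (_ * _); field; rewrite !gt_eqF.
  have xy0 : 0 < (x - y) / (x * y) by rewrite divr_gt0 ?mulr_gt0 ?subr_gt0.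
  rewrite -(ler_pM2l xy0) -E; apply: le_trans h2.
  rewrite le_eqVlt; apply/orP; left; apply/eqP.
  by rewrite exprS; field; rewrite !gt_eqF.
have upper y : x < y -> J <= c * j.+1%:R * x * y ^+ j.+1.
  move=> xy; have y0 : 0 < y by exact: lt_trans xy.
  have yV : y^-1 <= a by rewrite aE lef_pV2 ?posrE // ltW.
  have := key _ _ yV; rewrite -(fineK Jfin) -/J /F !IHj ?invr_gt0 // -/c.
  rewrite -EFinM -EFinD lee_fin {1 2}aE !exprVn !invrK => h.
  have T := exprS_ge_tangent j (ltW x0) (ltW y0).
  have {}h : (x^-1 - y^-1) * J <= c * (y ^+ j.+1 - x ^+ j.+1) by lra.
  have h2 : (x^-1 - y^-1) * J <= c * (j.+1%:R * (y - x) * y ^+ j).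
    by apply: (le_trans h); apply: ler_wpM2l => //; lra.
  have E : (x^-1 - y^-1) * J = (y - x) / (x * y) * J.
    by congr (_ * _); field; rewrite !gt_eqF.
  have xy0 : 0 < (y - x) / (x * y) by rewrite divr_gt0 ?mulr_gt0 ?subr_gt0.
  rewrite -(ler_pM2l xy0) -E; apply: (le_trans h2).
  rewrite le_eqVlt; apply/orP; left; apply/eqP.
  by rewrite exprS; field; rewrite !gt_eqF.
have cv : c * j.+1%:R * x * y ^+ j.+1 @[y --> x] --> c * j.+1%:R * x * x ^+ j.+1.
  apply: cvgM; first exact: cvg_cst.
  exact: exprn_continuous.
have -> : pi * (j.+1)`!%:R / a ^+ j.+2 = c * j.+1%:R * x * x ^+ j.+1.
  by rewrite factS natrM /c aE exprVn invrK exprS; ring.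
apply/eqP; rewrite eq_le; apply/andP; split.
- apply: (cvgr_to_ge (cvg_at_right_filter cv)).
  by near=> y; apply: upper; near: y; exact: nbhs_right_gt.
- apply: (cvgr_to_le (cvg_at_left_filter cv)).
  by near=> y; apply: lower; near: y; [exact: nbhs_left_gt|exact: nbhs_left_lt].
Unshelve. all: by end_near.
Qed.

End gaussian_moments.

(** * The complex exponential series *)

Section complex_exponential.
Context {R : realType}.
Implicit Types (z w : R[i]) (x y : R).

Definition cvg_complex (u : nat -> R[i]) (l : R[i]) : Prop :=
  complex.Re (u n) @[n --> \oo] --> complex.Re l /\
  complex.Im (u n) @[n --> \oo] --> complex.Im l.

Lemma cvg_complex_cst z : cvg_complex (fun=> z) z.
Proof. by split; exact: cvg_cst. Qed.
Lemma cvg_complexD (u v : nat -> R[i]) z w : cvg_complex u z -> cvg_complex v w ->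
  cvg_complex (fun n => u n + v n) (z + w).
Proof.
move=> [u1 u2] [v1 v2]; split.
  by under eq_fun do rewrite cReD; rewrite cReD; exact: cvgD.
by under eq_fun do rewrite cImD; rewrite cImD; exact: cvgD.
Qed.
Lemma cvg_complexM (u v : nat -> R[i]) z w : cvg_complex u z -> cvg_complex v w ->
  cvg_complex (fun n => u n * v n) (z * w).
Proof.
move=> [u1 u2] [v1 v2]; split.
  by under eq_fun do rewrite cReM; rewrite cReM; apply: cvgB; exact: cvgM.
by under eq_fun do rewrite cImM; rewrite cImM; apply: cvgD; exact: cvgM.
Qed.
Lemma cvg_complex_sum (I : Type) (r : seq I) (P : pred I) (u : I -> nat -> R[i])
    (l : I -> R[i]) : (forall i, P i -> cvg_complex (u i) (l i)) ->
  cvg_complex (fun n => \sum_(i <- r | P i) u i n) (\sum_(i <- r | P i) l i).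
Proof.
move=> h; elim: r => [|i r IHr].
  by under eq_fun do rewrite big_nil; rewrite big_nil; exact: cvg_complex_cst.
under eq_fun do rewrite big_cons; rewrite big_cons.
by case: ifP => // Pi; apply: cvg_complexD => //; exact: h.
Qed.
Lemma cvg_complex_prod (I : Type) (r : seq I) (P : pred I) (u : I -> nat -> R[i])
    (l : I -> R[i]) : (forall i, P i -> cvg_complex (u i) (l i)) ->
  cvg_complex (fun n => \prod_(i <- r | P i) u i n) (\prod_(i <- r | P i) l i).
Proof.
move=> h; elim: r => [|i r IHr].
  by under eq_fun do rewrite big_nil; rewrite big_nil; exact: cvg_complex_cst.
under eq_fun do rewrite big_cons; rewrite big_cons.
by case: ifP => // Pi; apply: cvg_complexM => //; exact: h.
Qed.
Lemma cvg_complex_det k (A : nat -> 'M[R[i]]_k) (B : 'M[R[i]]_k) :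
  (forall i j, cvg_complex (fun n => A n i j) (B i j)) ->
  cvg_complex (fun n => \det (A n)) (\det B).
Proof.
move=> h; apply: cvg_complex_sum => s _; apply: cvg_complexM; first exact: cvg_complex_cst.
by apply: cvg_complex_prod => i _; exact: h.
Qed.
Lemma cvg_complex_normc (u v : nat -> R[i]) l :
  cvg_complex u l -> normc (u n - v n) @[n --> \oo] --> 0 -> cvg_complex v l.
Proof.
move=> [u1 u2] uv.
have sub0 (f : R[i] -> R) : (forall z, `|f z| <= normc z) ->
    (forall n, f (u n) - f (v n) = f (u n - v n)) ->
    f (u n) - f (v n) @[n --> \oo] --> 0.
  move=> fn fB; apply/norm_cvg0P; apply: (squeeze_cvgr _ (cvg_cst 0) uv).
  by apply: nearW => n; rewrite fB normr_ge0 fn.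
have [v1 v2] : (fun n => complex.Re (v n)) = (fun n => complex.Re (u n) - (complex.Re (u n) - complex.Re (v n)))
  /\ (fun n => complex.Im (v n)) = (fun n => complex.Im (u n) - (complex.Im (u n) - complex.Im (v n))).
  by split; apply/funext => n; ring.
split.
  rewrite v1 -[X in _ --> X]subr0; apply: cvgB => //.
  by apply: sub0 => [|n]; [exact: Re_le_normc|case: (u n); case: (v n)].
rewrite v2 -[X in _ --> X]subr0; apply: cvgB => //.
by apply: sub0 => [|n]; [exact: Im_le_normc|case: (u n); case: (v n)].
Qed.

Lemma expCD z w : expC (z + w) = expC z * expC w.
Proof.
case: z => a b; case: w => c d; rewrite /expC /= cosD sinD expRD.
by apply/eqP; rewrite eq_complex /=; apply/andP; split; apply/eqP; ring.
Qed.
Lemma expC_conj z : expC (conjc z) = conjc (expC z).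
Proof.
case: z => a b; rewrite /expC /= cosN sinN.
by apply/eqP; rewrite eq_complex /=; apply/andP; split; apply/eqP; ring.
Qed.
Lemma expC0 : expC 0 = 1 :> R[i].
Proof.
rewrite /expC /= expR0 cos0 sin0.
by apply/eqP; rewrite eq_complex /=; apply/andP; split; apply/eqP; ring.
Qed.
Lemma expC_real x : expC (real_complex R x) = real_complex R (expR x).
Proof.
rewrite /expC /= cos0 sin0.
by apply/eqP; rewrite eq_complex /=; apply/andP; split; apply/eqP; ring.
Qed.
Lemma expC_im (x : R) n : expC (Complex 0 x) ^+ n = expC (Complex 0 (n%:R * x)).
Proof.
elim: n => [|n IHn]; first by rewrite expr0 mul0r expC0.
rewrite exprS IHn -expCD; congr expC.
by apply/eqP; rewrite eq_complex /=; apply/andP; split; apply/eqP;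
  rewrite -?natr1; ring.
Qed.

Section exponential_series.
Variable F : numFieldType.

Definition exp_sum (M : nat) (z : F) : F := \sum_(0 <= j < M) z ^+ j / j`!%:R.

Lemma triangular_sum (V : zmodType) (G : nat -> nat -> V) M :
  \sum_(0 <= n < M) \sum_(0 <= j < n.+1) G j (n - j)%N =
  \sum_(0 <= j < M) \sum_(0 <= l < M - j) G j l.
Proof.
elim: M => [|M IHM]; first by rewrite !big_nil.
rewrite big_nat_recr //= IHM [RHS]big_nat_recr //= subSnn big_nat1.
rewrite [X in _ + X]big_nat_recr //= subnn addrA; congr (_ + _).
rewrite -big_split /= big_nat [RHS]big_nat; apply: eq_bigr => j /andP[_ jM].
by rewrite (subSn (ltnW jM)) [RHS]big_nat_recr.
Qed.

Lemma exp_sumD M (a b : F) :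
  exp_sum M (a + b) = \sum_(0 <= j < M) \sum_(0 <= l < M - j)
    (a ^+ j / j`!%:R) * (b ^+ l / l`!%:R).
Proof.
rewrite -(triangular_sum (fun j l => (a ^+ j / j`!%:R) * (b ^+ l / l`!%:R))).
apply: eq_bigr => n _.
rewrite addrC exprDn mulr_suml big_mkord; apply: eq_bigr => i _.
have ni : (i <= n)%N by rewrite -ltnS.
have nf m : m`!%:R != 0 :> F by rewrite pnatr_eq0 -lt0n fact_gt0.
rewrite -(bin_fact ni) !natrM -mulr_natr.
have bn : 'C(n, i)%:R != 0 :> F by rewrite pnatr_eq0 -lt0n bin_gt0.
by field; rewrite !nf.
Qed.

(** The product of truncated exponentials contains the terms of the truncated
    exponential of the sum, and the excess is bounded by the same excess for
    moduli. *)
Lemma exp_sumM_sub M (a b : F) :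
  exp_sum M a * exp_sum M b - exp_sum M (a + b) =
  \sum_(0 <= j < M) \sum_(M - j <= l < M)
    (a ^+ j / j`!%:R) * (b ^+ l / l`!%:R).
Proof.
rewrite exp_sumD /exp_sum mulr_suml -sumrB; apply: eq_big_nat => j /andP[_ jM].
rewrite mulr_sumr (big_cat_nat _ _ (n := (M - j)%N)) //= ?leq_subr //.
by rewrite addrAC subrr add0r.
Qed.
End exponential_series.

Lemma exp_sum_normc M z : normc (exp_sum M z) <= exp_sum M (normc z).
Proof.
apply: le_trans (normc_sum _ _ _) _; apply: ler_sum => j _.
by rewrite normcM normcV normcX -(rmorph_nat (real_complex R)) normc_real normr_nat.
Qed.

Lemma exp_sum_le_expR M x : 0 <= x -> exp_sum M x <= expR x.
Proof.
move=> x0; rewrite /expR; apply: (@nondecreasing_cvgn_le _ (series (exp_coeff x))).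
  apply/nondecreasing_seqP => n; rewrite /series /= big_nat_recr //= lerDl.
  exact: exp_coeff_ge0.
exact: is_cvg_series_exp_coeff.
Qed.

Lemma exp_sum_real M x : exp_sum M (real_complex R x) = real_complex R (exp_sum M x).
Proof.
rewrite /exp_sum rmorph_sum; apply: eq_bigr => j _.
by rewrite rmorphM rmorphXn fmorphV rmorph_nat.
Qed.

Lemma exp_sum_im M x : exp_sum M (Complex 0 x) =
  Complex (series (cos_coeff x) M) (series (sin_coeff x) M).
Proof.
rewrite /exp_sum /series /=.
have -> : Complex (\sum_(0 <= k < M) cos_coeff x k) (\sum_(0 <= k < M) sin_coeff x k)
  = \sum_(0 <= k < M) Complex (cos_coeff x k) (sin_coeff x k).
  by elim/big_rec3: _ => // i a b c _ <-.
apply: eq_bigr => j _.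
have -> : (Complex 0 x) ^+ j = Complex ((~~ odd j)%:R * (-1) ^+ j./2 * x ^+ j)
    ((odd j)%:R * (-1) ^+ j.-1./2 * x ^+ j).
  elim: j => [|j IHj]; first by apply/eqP; rewrite eq_complex /= !expr0 ?mulr1 ?mul0r !eqxx.
  rewrite exprSr IHj; apply/eqP; rewrite eq_complex /= !exprSr.
  have [oj|oj] := boolP (odd j); rewrite uphalf_half ?oj ?(negbTE oj) /=.
    have -> : j./2 = j.-1./2 by rewrite -[j in LHS]odd_double_half oj -[j in RHS]odd_double_half oj /= add0n uphalf_double doubleK.
    by rewrite add1n exprS !(mul0r, mul1r, mulr0, subr0, sub0r, addr0, add0r, mulrA, mulN1r, mulNr) !eqxx.
  by rewrite !(mul0r, mul1r, mulr0, subr0, addr0, add0r, mulrA) oppr0 !eqxx.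
rewrite -(rmorph_nat (real_complex R) j`!) -fmorphV.
apply/eqP; rewrite eq_complex /= /cos_coeff /sin_coeff /=.
by rewrite !mulr0 subr0 add0r !eqxx.
Qed.

(** The series of the real exponential, of the cosine and of the sine give the
    claim for real and for imaginary arguments; the two are multiplied by
    [exp_sumM_sub]. *)
Lemma exp_sum_cvg z : cvg_complex (fun M => exp_sum M z) (expC z).
Proof.
case: z => x y.
have zE : Complex x y = real_complex R x + Complex 0 y.
  by apply/eqP; rewrite eq_complex /= addr0 add0r !eqxx.
have cx : cvg_complex (fun M => exp_sum M (real_complex R x)) (expC (real_complex R x)).
  rewrite expC_real; under eq_fun do rewrite exp_sum_real.
  split=> /=; last exact: cvg_cst.
  exact: is_cvg_series_exp_coeff.
have cy : cvg_complex (fun M => exp_sum M (Complex 0 y)) (expC (Complex 0 y)).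
  rewrite /expC /= expR0 mul1r; under eq_fun do rewrite exp_sum_im.
  split => /=.
    by rewrite unlock; exact: is_cvg_series_cos_coeff.
  by rewrite unlock; exact: is_cvg_series_sin_coeff.
rewrite zE expCD; apply: cvg_complex_normc (cvg_complexM cx cy) _.
set a := real_complex R x; set b := Complex 0 y.
have lim0 : exp_sum M (normc a) * exp_sum M (normc b) - exp_sum M (normc a + normc b)
   @[M --> \oo] --> 0.
  rewrite -[X in _ --> X](subrr (expR (normc a + normc b))).
  apply: cvgB; last exact: is_cvg_series_exp_coeff.
  by rewrite expRD; apply: cvgM; exact: is_cvg_series_exp_coeff.
clearbody a b.
apply: (squeeze_cvgr _ (cvg_cst 0) lim0); apply: nearW => M.
rewrite normc_ge0 !exp_sumM_sub.
apply: le_trans (normc_sum _ _ _) _; apply: ler_sum => j _.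
apply: le_trans (normc_sum _ _ _) _; apply: ler_sum => l _.
rewrite !normcM !normcV !normcX -!(rmorph_nat (real_complex R)) !normc_real.
by rewrite !normr_nat.
Qed.
End complex_exponential.

(** * Integrals of complex functions and of tensor products *)

Section real_product.
Context {d1 d2 : measure_display} {T1 : measurableType d1}
  {T2 : measurableType d2} {R : realType}
  (m1 : {sigma_finite_measure set T1 -> \bar R})
  (m2 : {sigma_finite_measure set T2 -> \bar R}).
Variables (f : T1 -> R) (g : T2 -> R).
Hypotheses (intf : m1.-integrable setT (EFin \o f))
  (intg : m2.-integrable setT (EFin \o g)).

Lemma integrable_tensor : (m1 \x m2)%E.-integrable setT
  (EFin \o (fun p => f p.1 * g p.2)).
Proof.
have mf := measurable_int _ intf; have mg := measurable_int _ intg.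
have mfg : measurable_fun setT (EFin \o (fun p => f p.1 * g p.2)).
  apply/measurable_EFinP; apply: measurable_funM.
    apply: (measurableT_comp _ measurable_fst); exact/measurable_EFinP.
  apply: (measurableT_comp _ measurable_snd); exact/measurable_EFinP.
apply/integrable12ltyP => //.
have mag : measurable_fun setT (fun y => `|(g y)%:E|%E) by exact: measurableT_comp.
have maf : measurable_fun setT (fun y => `|(f y)%:E|%E) by exact: measurableT_comp.
have fin_g : (\int[m2]_y `|(g y)%:E| \is a fin_num)%E.
  by apply: integrable_fin_num => //; exact: integrable_abse.
rewrite (eq_integral (fun x => (\int[m2]_y `|(g y)%:E|) * `|(f x)%:E|)%E); last first.
  move=> x _; transitivity (\int[m2]_y (`|(f x)%:E| * `|(g y)%:E|))%E.
    by apply: eq_integral => y _; rewrite -abseM -EFinM.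
  by rewrite ge0_integralZl // muleC.
rewrite ge0_integralZl //; last by apply: integral_ge0.
rewrite lte_mul_pinfty ?integral_ge0 //.
exact/integrable_lty/integrable_abse.
Qed.

Lemma Rintegral_tensor :
  \int[(m1 \x m2)%E]_p (f p.1 * g p.2) = (\int[m1]_x f x) * (\int[m2]_y g y).
Proof.
rewrite {1}/Rintegral -(integral12_prod_meas1 integrable_tensor) /fubini_F /=.
rewrite (eq_integral (fun x => (f x * \int[m2]_y g y)%:E)); last first.
  move=> x _; under eq_integral do rewrite /= EFinM.
  rewrite integralZl // EFinM; congr (_ * _)%E.
  by rewrite /Rintegral fineK //; exact: integrable_fin_num.
by rewrite -[LHS]/(\int[m1]_x (f x * _)) RintegralZr.
Qed.
End real_product.

Section complex_integral.
Context {d : measure_display} {T : measurableType d} {R : realType}.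
Variable m : {measure set T -> \bar R}.
Implicit Types f g : T -> R[i].

Definition cintegrable f : Prop :=
  m.-integrable setT (EFin \o (fun x => complex.Re (f x))) /\
  m.-integrable setT (EFin \o (fun x => complex.Im (f x))).

Definition cintegral f : R[i] :=
  Complex (\int[m]_x complex.Re (f x)) (\int[m]_x complex.Im (f x)).

Lemma cintegrable0 : cintegrable (fun=> 0).
Proof. by split; exact: integrable0. Qed.

Lemma cintegral0 : cintegral (fun=> 0) = 0.
Proof. by rewrite /cintegral /= /Rintegral integral0. Qed.

Lemma cintegrableD f g : cintegrable f -> cintegrable g ->
  cintegrable (fun x => f x + g x).
Proof.
move=> [f1 f2] [g1 g2]; split.
  under eq_fun do rewrite cReD; exact: (integrableD _ f1 g1).
under eq_fun do rewrite cImD; exact: (integrableD _ f2 g2).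
Qed.

Lemma cintegralD f g : cintegrable f -> cintegrable g ->
  cintegral (fun x => f x + g x) = cintegral f + cintegral g.
Proof.
move=> [f1 f2] [g1 g2]; rewrite /cintegral.
under eq_Rintegral do rewrite cReD; under [X in Complex _ X]eq_Rintegral do rewrite cImD.
by rewrite !RintegralD.
Qed.

Lemma cintegrableZ (c : R[i]) f : cintegrable f -> cintegrable (fun x => c * f x).
Proof.
move=> [f1 f2]; split.
  under eq_fun do rewrite cReM.
  exact: (integrableB _ (integrableZl _ (complex.Re c) f1) (integrableZl _ (complex.Im c) f2)).
under eq_fun do rewrite cImM.
exact: (integrableD _ (integrableZl _ (complex.Re c) f2) (integrableZl _ (complex.Im c) f1)).
Qed.

Lemma cintegralZ (c : R[i]) f : cintegrable f ->
  cintegral (fun x => c * f x) = c * cintegral f.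
Proof.
move=> [f1 f2]; rewrite /cintegral.
under eq_Rintegral do rewrite cReM; under [X in Complex _ X]eq_Rintegral do rewrite cImM.
have Z a (h : T -> R) : m.-integrable setT (EFin \o h) ->
  m.-integrable setT (EFin \o (fun x => a * h x)) by move=> ih; exact: (integrableZl _ a ih).
rewrite RintegralB ?RintegralD //; try exact: Z.
rewrite !RintegralZl //.
by case: c.
Qed.

Lemma cintegrable_sum (I : Type) (r : seq I) (P : pred I) (f : I -> T -> R[i]) :
  (forall i, P i -> cintegrable (f i)) ->
  cintegrable (fun x => \sum_(i <- r | P i) f i x).
Proof.
move=> h; elim: r => [|i r IHr].
  rewrite (_ : (fun x : T => \sum_(i <- [::] | P i) f i x) = (fun _ : T => 0 : R[i])); first exact: cintegrable0.
  by apply/funext => x; rewrite big_nil.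
rewrite (_ : (fun x : T => \sum_(j <- i :: r | P j) f j x) = (fun x : T => (if P i then f i x else 0) + \sum_(j <- r | P j) f j x)).
  by case: (P i) (h i) => Pi; apply: cintegrableD => //; [exact: Pi|exact: cintegrable0].
by apply/funext => x; rewrite big_cons; case: ifP => //; rewrite add0r.
Qed.

Lemma cintegral_sum (I : Type) (r : seq I) (P : pred I) (f : I -> T -> R[i]) :
  (forall i, P i -> cintegrable (f i)) ->
  cintegral (fun x => \sum_(i <- r | P i) f i x) =
  \sum_(i <- r | P i) cintegral (f i).
Proof.
move=> h; elim: r => [|i r IHr].
  rewrite (_ : (fun x : T => \sum_(i <- [::] | P i) f i x) = (fun _ : T => 0 : R[i])); first by rewrite big_nil cintegral0.
  by apply/funext => x; rewrite big_nil.
rewrite (_ : (fun x : T => \sum_(j <- i :: r | P j) f j x) = (fun x : T => (if P i then f i x else 0) + \sum_(j <- r | P j) f j x)).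
  rewrite big_cons; case: (P i) (h i) => Pi; rewrite cintegralD ?IHr ?cintegral0 ?add0r //;
    try exact: cintegrable_sum; [exact: Pi|exact: cintegrable0].
by apply/funext => x; rewrite big_cons; case: ifP => //; rewrite add0r.
Qed.

End complex_integral.

Section complex_tensor.
Context {d1 d2 : measure_display} {T1 : measurableType d1}
  {T2 : measurableType d2} {R : realType}
  (m1 : {sigma_finite_measure set T1 -> \bar R})
  (m2 : {sigma_finite_measure set T2 -> \bar R}).
Variables (f : T1 -> R[i]) (g : T2 -> R[i]).
Hypotheses (intf : cintegrable m1 f) (intg : cintegrable m2 g).

Lemma cintegrable_tensor : cintegrable (m1 \x m2)%E (fun p => f p.1 * g p.2).
Proof.
move: intf intg => [f1 f2] [g1 g2]; split.
  under eq_fun do rewrite cReM.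
  exact: (integrableB _ (integrable_tensor f1 g1) (integrable_tensor f2 g2)).
under eq_fun do rewrite cImM.
exact: (integrableD _ (integrable_tensor f1 g2) (integrable_tensor f2 g1)).
Qed.

Lemma cintegral_tensor :
  cintegral (m1 \x m2)%E (fun p => f p.1 * g p.2) = cintegral m1 f * cintegral m2 g.
Proof.
move: intf intg => [f1 f2] [g1 g2]; rewrite /cintegral.
under eq_Rintegral do rewrite cReM; under [X in Complex _ X]eq_Rintegral do rewrite cImM.
rewrite RintegralB // ?RintegralD //.
rewrite (Rintegral_tensor f1 g1) (Rintegral_tensor f2 g2)
  (Rintegral_tensor f1 g2) (Rintegral_tensor f2 g1) //.
- exact: (integrable_tensor f1 g2).
- exact: (integrable_tensor f2 g1).
- exact: (integrable_tensor f1 g1).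
- exact: (integrable_tensor f2 g2).
Qed.
End complex_tensor.

Section complex_tuple.
Context {d : measure_display} {T : measurableType d} {R : realType}
  (m : {sigma_finite_measure set T -> \bar R}).

Lemma cintegral_tuple k (f : 'I_k -> T -> R[i]) :
  (forall i, cintegrable m (f i)) ->
  cintegrable (tuple_measure m k) (fun t => \prod_(i < k) f i (tnth t i)) /\
  cintegral (tuple_measure m k) (fun t => \prod_(i < k) f i (tnth t i)) =
  \prod_(i < k) cintegral m (f i).
Proof.
elim: k f => [|k IHk] f intf.
  rewrite (_ : (fun t : 0.-tuple T => _) = fun=> 1); last first.
    by apply/funext => t; rewrite big_ord0.
  rewrite big_ord0 /cintegrable /cintegral /= /Rintegral !integral_dirac //=.
  rewrite indicT mul1r mul1r; split=> //.
  by split; exact: finite_measure_integrable_cst.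
have [int' E'] := IHk (fun i => f (lift ord0 i)) (fun i => intf _).
set nu := tuple_measure m k in int' E'.
pose G := fun p : T * k.-tuple T => f ord0 p.1 *
   \prod_(i < k) f (lift ord0 i) (tnth p.2 i).
pose F := fun t : k.+1.-tuple T => \prod_(i < k.+1) f i (tnth t i).
have FG p : F (tuple_cons p) = G p.
  rewrite /F /G big_ord_recl; congr (f ord0 _ * _).
  by apply: eq_bigr => i _; congr (f _ _); rewrite !(tnth_nth p.1).
have intG : cintegrable (m \x nu)%E G := cintegrable_tensor (intf ord0) int'.
have EG : cintegral (m \x nu)%E G = cintegral m (f ord0) * _ := cintegral_tensor (intf ord0) int'.
have FE : F = G \o @tuple_uncons d T k.
  by apply/funext => t; rewrite /= -FG tuple_unconsK.
have mF (h : R[i] -> R) : (m \x nu)%E.-integrable setT (EFin \o (fun x => h (G x))) ->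
    measurable_fun setT (EFin \o (fun x => h (F x))).
  move=> /(measurable_int _) mG; rewrite FE.
  exact: (measurableT_comp mG (@measurable_tuple_uncons d T k)).
have key (h : R[i] -> R) : (m \x nu)%E.-integrable setT (EFin \o (fun x => h (G x))) ->
    (tuple_measureS m nu).-integrable setT (EFin \o (fun x => h (F x))) /\
    \int[tuple_measureS m nu]_x (h (F x)) = \int[(m \x nu)%E]_x (h (G x)).
  move=> iG.
  have iF : (m \x nu)%E.-integrable (@tuple_cons d T k @^-1` setT)
      ((EFin \o (fun x => h (F x))) \o @tuple_cons d T k).
    rewrite preimage_setT; apply: eq_integrable iG => // p _ /=.
    by rewrite FG.
  split.
    exact: (integrable_pushforward (@measurable_tuple_cons d T k) (mF _ iG) iF).
  rewrite /Rintegral.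
  rewrite [X in fine X](integral_pushforward (@measurable_tuple_cons d T k) (mF _ iG) iF) //.
  by rewrite preimage_setT; congr fine; apply: eq_integral => p _ /=; rewrite FG.
case: intG => iG1 iG2.
have [iF1 E1] := key _ iG1; have [iF2 E2] := key _ iG2.
split; first by split.
rewrite big_ord_recl -E' -EG /cintegral.
by congr Complex.
Qed.
End complex_tuple.

(** * Integrals of determinants *)

Section determinant_integral.
Context {d : measure_display} {T : measurableType d} {R : realType}
  (m : {sigma_finite_measure set T -> \bar R}).

(** The permutation is moved from the second factor to the index, so that each
    factor depends on one point only. *)
Lemma det_sum_prod (F : comPzRingType) (k M : nat) (f h : 'I_M -> 'I_k -> F) :
  \det (\matrix_(i < k, l < k) \sum_(j < M) f j i * h j l) =
  \sum_(s : 'S_k) \sum_(J : {ffun 'I_k -> 'I_M})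
    (-1) ^+ s * \prod_(i < k) (f (J i) i * h (J (s^-1%g i)) i).
Proof.
rewrite /determinant; apply: eq_bigr => s _.
under eq_bigr do rewrite mxE.
rewrite bigA_distr_bigA /= mulr_sumr; apply: eq_bigr => J _.
congr (_ * _); rewrite !big_split /=; congr (_ * _).
rewrite [RHS](reindex_inj (@perm_inj _ s)) /=.
by apply: eq_bigr => i _; rewrite permK.
Qed.

(** The integral of the determinant of a kernel of finite rank is a sum of
    minors, with repetitions, of the Gram matrix of the functions composing it
    (Cauchy-Binet). *)
Lemma cintegral_det (k M : nat) (f h : 'I_M -> T -> R[i]) :
  (forall j l, cintegrable m (fun x => f j x * h l x)) ->
  let F := fun t : k.-tuple T =>
    \det (\matrix_(i < k, l < k) \sum_(j < M) f j (tnth t i) * h j (tnth t l)) in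
  cintegrable (tuple_measure m k) F /\
  cintegral (tuple_measure m k) F =
  \sum_(J : {ffun 'I_k -> 'I_M})
    \det (\matrix_(i < k, l < k) cintegral m (fun x => f (J i) x * h (J l) x)).
Proof.
move=> int F.
pose P (s : 'S_k) (J : {ffun 'I_k -> 'I_M}) (t : k.-tuple T) :=
  \prod_(i < k) (f (J i) (tnth t i) * h (J (s^-1%g i)) (tnth t i)).
have FE : F = (fun t => \sum_(s : 'S_k) \sum_(J : {ffun 'I_k -> 'I_M})
    ((-1) ^+ s * P s J t)).
  apply/funext => t.
  exact: (det_sum_prod (fun j i => f j (tnth t i)) (fun j i => h j (tnth t i))).
have intP (s : 'S_k) (J : {ffun 'I_k -> 'I_M}) := cintegral_tuple (f := fun i x => f (J i) x * h (J (s^-1%g i)) x)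
  (fun i => int (J i) (J (s^-1%g i))).
have intZ (s : 'S_k) (J : {ffun 'I_k -> 'I_M}) : cintegrable (tuple_measure m k) (fun t => (-1) ^+ s * P s J t).
  by apply: cintegrableZ; exact: (intP s J).1.
rewrite FE; split; first by do 2 (apply: cintegrable_sum => ? _); exact: intZ.
rewrite cintegral_sum; last by move=> s _; apply: cintegrable_sum => J _; exact: intZ.
rewrite [RHS]exchange_big /=.
rewrite [RHS](reindex_inj invg_inj) /=; apply: eq_bigr => s _.
rewrite cintegral_sum; last by move=> J _; exact: intZ.
apply: eq_bigr => J _; rewrite cintegralZ; last exact: (intP s J).1.
rewrite (intP s J).2 odd_permV; congr (_ * _).
by apply: eq_bigr => i _; rewrite mxE.
Qed.

(** A repeated index gives two equal rows. *)
Lemma det_diagonal_gram (F : comPzRingType) (k M : nat) (g : 'I_M -> F) (J : 'I_k -> 'I_M) :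
  \det (\matrix_(i < k, l < k) (if J i == J l then g (J i) else 0)) =
  if injectiveb J then \prod_(i < k) g (J i) else 0.
Proof.
have [/injectiveP Ji|/injectivePn[i [l il Jil]]] := boolP (injectiveb J).
  rewrite (_ : \matrix_(_, _) _ = diag_mx (\row_i g (J i))).
    by rewrite det_diag; apply: eq_bigr => i _; rewrite mxE.
  apply/matrixP => i l; rewrite !mxE (inj_eq Ji).
  by case: eqVneq => [->|]; rewrite ?mulr1n ?mulr0n.
apply: (determinant_alternate il) => j; rewrite !mxE Jil.
by [].
Qed.
End determinant_integral.


(** * Eigenfunctions of the Ginibre kernel on a disc *)

Section disc_modes.
Context {R : realType}.
Local Notation plane := (plane R).
Local Notation lambda2 := (@plane_lebesgue R).

Lemma cintegral_area_preserving (g : plane -> plane) (f : plane -> R[i]) :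
  area_preserving g -> cintegrable lambda2 f ->
  cintegral lambda2 (fun z => f (g z)) = cintegral lambda2 f.
Proof.
move=> [mg hg] [/(measurable_int _) f1 /(measurable_int _) f2].
by rewrite /cintegral /Rintegral (hg _ f1) (hg _ f2).
Qed.

Lemma indic_in (T : Type) (D : set T) (z : T) : D z -> \1_D z = 1 :> R.
Proof. by move=> Dz; rewrite indicE mem_set. Qed.
Lemma indic_out (T : Type) (D : set T) (z : T) : ~ D z -> \1_D z = 0 :> R.
Proof. by move=> Dz; rewrite indicE memNset. Qed.

Definition disc (rho : R) : set plane := [set z | sqnorm z <= rho ^+ 2].

Lemma measurable_disc rho : measurable (disc rho).
Proof.
rewrite [X in measurable X](_ : _ = sqnorm @^-1` `]-oo, rho ^+ 2]).
  by rewrite -[X in measurable X]setTI; apply: measurable_sqnorm.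
by apply/seteqP; split => z /=; rewrite in_itv.
Qed.

(** The Gaussian is integrable and bounded below on the disc. *)
Lemma disc_area_lty rho : (lambda2 (disc rho) < +oo)%E.
Proof.
have : (\int[lambda2]_(z in disc rho) (expR (- rho ^+ 2))%:E <= (pi / 1)%:E)%E.
  rewrite -(gauss_integral_plane (ltr01)).
  have mD := measurable_disc rho.
  have me : measurable_fun setT (fun z : plane => (expR (- 1 * sqnorm z))%:E).
    have /measurable_EFinP := measurable_sqnorm_gauss 0 (1 : R).
    by under eq_fun do rewrite expr0 mul1r.
  apply: (@le_trans _ _ (\int[lambda2]_(z in disc rho) (expR (- 1 * sqnorm z))%:E)%E).
    apply: ge0_le_integral => //.
    - exact: measurable_funTS.
    - by move=> z zD; rewrite lee_fin ler_expR mulN1r lerN2.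
  by apply: ge0_subset_integral => // z _; rewrite lee_fin expR_ge0.
rewrite integral_cst //; last exact: measurable_disc.
set A := (X in (_ * X)%E); rewrite -[X in _ -> (X < _)%E]/A; clearbody A.
case: A => [r _||//]; first by rewrite ltry.
by rewrite gt0_muley ?lte_fin ?expR_gt0 // leye_eq.
Qed.

Definition bounded_measurable (f : plane -> R[i]) : Prop :=
  [/\ measurable_fun setT (fun z => complex.Re (f z)),
      measurable_fun setT (fun z => complex.Im (f z)) &
      exists M, forall z, normc (f z) <= M].

Lemma bounded_measurableM f g : bounded_measurable f -> bounded_measurable g ->
  bounded_measurable (fun z => f z * g z).
Proof.
move=> [f1 f2 [M fM]] [g1 g2 [N gN]]; split.
- under eq_fun do rewrite cReM.
  by apply: measurable_funB; exact: measurable_funM.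
- under eq_fun do rewrite cImM.
  by apply: measurable_funD; exact: measurable_funM.
- exists (M * N) => z; rewrite normcM ler_pM ?normc_ge0 //.
Qed.

Lemma bounded_measurable1 : bounded_measurable (fun=> 1).
Proof. by split => //; exists 1 => z; rewrite normc1. Qed.

Lemma bounded_measurableX f j : bounded_measurable f ->
  bounded_measurable (fun z => f z ^+ j).
Proof.
move=> bf; elim: j => [|j IHj]; first exact: bounded_measurable1.
rewrite (_ : (fun z => f z ^+ j.+1) = (fun z => f z * f z ^+ j)).
  exact: bounded_measurableM.
by apply/funext => z; rewrite exprS.
Qed.

Lemma bounded_measurable_conj f : bounded_measurable f ->
  bounded_measurable (fun z => conjc (f z)).
Proof.
move=> [f1 f2 [M fM]]; split.
- by rewrite (_ : (fun z => _) = (fun z => complex.Re (f z))) //; apply/funext => z; case: (f z).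
- rewrite (_ : (fun z => _) = (fun z => - complex.Im (f z))).
    exact: measurable_funN.
  by apply/funext => z; case: (f z).
- by exists M => z; rewrite normc_conj.
Qed.

Lemma cintegrable_bounded rho f : bounded_measurable f ->
  (forall z, ~ disc rho z -> f z = 0) -> cintegrable lambda2 f.
Proof.
move=> [f1 f2 [M fM]] f0.
have mD := measurable_disc rho.
have iD : lambda2.-integrable setT (EFin \o (fun z => M * \1_(disc rho) z)).
  have i1 : lambda2.-integrable setT (EFin \o \1_(disc rho)).
    apply/integrableP; split; first exact/measurable_EFinP.
    rewrite (eq_integral (fun z => (\1_(disc rho) z)%:E)); last first.
      by move=> z _; rewrite gee0_abs // lee_fin.
    by rewrite integral_indic // setIT; exact: disc_area_lty.
  exact: (integrableZl _ M i1).
have key (h : R[i] -> R) : (forall z, `|h z| <= normc z) ->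
  measurable_fun setT (fun z => h (f z)) ->
  lambda2.-integrable setT (EFin \o (fun z => h (f z))).
  move=> hn mh; apply: (le_integrable _ _ _ iD) => //.
    exact/measurable_EFinP.
  move=> z _ /=; rewrite lee_fin.
  have [zD|zD] := pselect (disc rho z).
    rewrite indic_in // mulr1; apply: le_trans (hn _) _.
    by apply: le_trans (fM z) _; rewrite ler_norm.
  rewrite f0 // indic_out // mulr0 normr0.
  by apply: le_trans (hn _) _; rewrite normc0.
by split; apply: key => //; [exact: Re_le_normc|exact: Im_le_normc].
Qed.

(** The weight is the square root of the Gaussian density, up to
    normalization; restricted to the disc, these functions diagonalize the
    kernel. *)
Definition mode (rho : R) (j : nat) (z : plane) : R[i] :=
  plane_to_C z ^+ j *
  real_complex R (expR (- (pi / 2) * sqnorm z) * \1_(disc rho) z).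

Lemma normc_plane z : normc (plane_to_C z : R[i]) = Num.sqrt (sqnorm z).
Proof. by []. Qed.

Lemma mode_bounded rho j : bounded_measurable (mode rho j).
Proof.
have mD := measurable_disc rho.
pose w (z : plane) : R[i] := real_complex R (\1_(disc rho) z) * plane_to_C z.
pose g (z : plane) : R[i] := real_complex R (expR (- (pi / 2) * sqnorm z) * \1_(disc rho) z).
have -> : mode rho j = (fun z => w z ^+ j * g z).
  apply/funext => z; rewrite /mode /w /g exprMn; have [zD|zD] := pselect (disc rho z).
    by rewrite indic_in // rmorph1 expr1n mul1r.
  by rewrite indic_out // !mulr0.
have bw : bounded_measurable w.
  split.
  - rewrite (_ : (fun z => _) = (fun z : plane => \1_(disc rho) z * z.1)).
      by apply: measurable_funM; [exact: measurable_indic|exact: measurable_fst].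
    by apply/funext => z; rewrite /w cReM /= mul0r subr0.
  - rewrite (_ : (fun z => _) = (fun z : plane => \1_(disc rho) z * z.2)).
      by apply: measurable_funM; [exact: measurable_indic|exact: measurable_snd].
    by apply/funext => z; rewrite /w cImM /= mul0r addr0.
  - exists `|rho| => z; rewrite /w normcM normc_real normc_plane.
    have [zD|zD] := pselect (disc rho z); last by rewrite indic_out // normr0 mul0r.
    by rewrite indic_in // normr1 mul1r -sqrtr_sqr ler_wsqrtr.
have bg : bounded_measurable g.
  split.
  - rewrite /g /=; apply: measurable_funM; last exact: measurable_indic.
    have := measurable_sqnorm_gauss 0 (pi / 2 : R).
    by under eq_fun do rewrite expr0 mul1r.
  - exact: measurable_cst.
  - exists 1 => z; rewrite /g normc_real ger0_norm.
      rewrite -[leRHS]mulr1 ler_pM ?expR_ge0 ?indicE //.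
        rewrite -expR0 ler_expR mulNr oppr_le0 mulr_ge0 ?sqnorm_ge0 //.
        by rewrite divr_ge0 ?pi_ge0.
      by case: (_ \in _).
    by rewrite mulr_ge0 ?expR_ge0 // indicE.
exact/bounded_measurableM/bg/bounded_measurableX.
Qed.

Lemma mode_out rho j z : ~ disc rho z -> mode rho j z = 0.
Proof. by move=> zD; rewrite /mode indic_out // !mulr0. Qed.

Definition mode_prod rho j l z := mode rho j z * conjc (mode rho l z).

Lemma mode_prod_integrable rho j l : cintegrable lambda2 (mode_prod rho j l).
Proof.
apply: (@cintegrable_bounded rho).
  apply: bounded_measurableM; first exact: mode_bounded.
  by apply: bounded_measurable_conj; exact: mode_bounded.
by move=> z zD; rewrite /mode_prod mode_out // mul0r.
Qed.

Lemma mode_prod_conj rho j l : cintegral lambda2 (mode_prod rho l j) =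
  conjc (cintegral lambda2 (mode_prod rho j l)).
Proof.
have [f1 f2] := mode_prod_integrable rho j l.
rewrite /cintegral /=; congr Complex.
  apply: eq_Rintegral => z _; rewrite /mode_prod.
  by move: (mode rho j z) (mode rho l z) => [a b] [a' b'] /=; ring.
rewrite -[RHS]mulN1r -RintegralZl //.
apply: eq_Rintegral => z _; rewrite /mode_prod.
by move: (mode rho j z) (mode rho l z) => [a b] [a' b'] /=; ring.
Qed.

(** The rotation of angle pi / (2 (j - l)) multiplies the product of the two
    modes by the imaginary unit, while it preserves the integral. *)
Lemma mode_orthogonal rho j l : j != l ->
  cintegral lambda2 (mode_prod rho j l) = 0.
Proof.
wlog: j l / (l < j)%N => [wl|lj _].
  move=> jl; case: (ltnP l j) => [h|]; first exact: wl.
  rewrite leq_eqVlt (negbTE jl) /= => h.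
  by rewrite mode_prod_conj (wl _ _ h) ?conjc0 // eq_sym.
have [n n0 {lj}->] : exists2 n, (0 < n)%N & j = (n + l)%N.
  by exists (j - l)%N; rewrite ?subn_gt0 // subnK // ltnW.
pose th : R := pi / 2 / n%:R.
have jl0 : n%:R != 0 :> R by rewrite pnatr_eq0 -lt0n.
pose c := cos th; pose s := sin th.
have cs : c ^+ 2 + s ^+ 2 = 1 by exact: cos2Dsin2.
have c1 : 1 + c != 0.
  rewrite gt_eqF // ltr_pwDl // cos_ge0_pihalf //.
  have th0 : 0 <= th by rewrite !divr_ge0 ?pi_ge0.
  rewrite (le_trans _ th0) /=; last by rewrite oppr_le0 divr_ge0 ?pi_ge0.
  rewrite ler_pdivrMr ?ltr0n // ler_peMr ?divr_ge0 ?pi_ge0 //.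
  by rewrite ler1n.
have rot := area_preserving_rotation cs c1.
pose u : R[i] := Complex c s.
have uE : u = expC (Complex 0 th).
  by rewrite /expC /= expR0 /u /c /s; apply/eqP; rewrite eq_complex /=; apply/andP; split; apply/eqP; ring.
have uu : u * conjc u = 1.
  rewrite /u; apply/eqP; rewrite eq_complex /=; apply/andP; split; apply/eqP; last by ring.
  by rewrite -cs; ring.
have um : u ^+ n = Complex 0 1.
  rewrite uE expC_im /th mulrC divfK // /expC /= expR0 cos_pihalf sin_pihalf.
  by apply/eqP; rewrite eq_complex /=; apply/andP; split; apply/eqP; ring.
set I := cintegral _ _.
have : I = Complex 0 1 * I.
  rewrite -cintegralZ; last exact: mode_prod_integrable.
  rewrite /I -(cintegral_area_preserving rot (mode_prod_integrable rho (n + l) l)).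
  congr (cintegral _ _); apply/funext => z; rewrite /mode_prod /mode.
  set z' := (_, _).
  have -> : sqnorm z' = sqnorm z.
    by rewrite /sqnorm /= -[RHS]mul1r -cs; ring.
  have -> : \1_(disc rho) z' = \1_(disc rho) z :> R.
    congr ((_ : bool)%:R); apply/idP/idP => /set_mem h; apply/mem_set; move: h;
    by rewrite /disc /= (_ : sqnorm z' = sqnorm z) // /sqnorm /= -[RHS]mul1r -cs; ring.
  have -> : plane_to_C z' = u * plane_to_C z.
    by apply/eqP; rewrite eq_complex /=; apply/andP; split; apply/eqP; ring.
  have ul : u ^+ l * conjc u ^+ l = 1 by rewrite -exprMn uu expr1n.
  rewrite -um !rmorphM !rmorphXn rmorphM !exprMn !exprD.
  rewrite -[RHS]mulr1 -ul; ring.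
by case: (I) => x y [] hx hy; apply/eqP; rewrite eq_complex /=; apply/andP; split; apply/eqP; lra.
Qed.
End disc_modes.

(** * Eigenvalues of the Ginibre kernel on a disc *)

Section eigenvalues.
Context {R : realType}.
Local Notation plane := (plane R).
Local Notation lambda2 := (@plane_lebesgue R).
Variable rho : R.

Definition mode_weight (j : nat) : R := pi ^+ j / j`!%:R.

(** The probability that a Gamma variable of shape [j + 1] and scale 1 is at
    most [pi * rho ^+ 2]. *)
Definition disc_eigenvalue (j : nat) : R :=
  \int[lambda2]_z (mode_weight j * (sqnorm z ^+ j * expR (- pi * sqnorm z) * \1_(disc rho) z)).

Lemma mode_weight_ge0 j : 0 <= mode_weight j.
Proof. by rewrite divr_ge0 // exprn_ge0 // pi_ge0. Qed.

Lemma mode_prodjj j z : mode_prod rho j j z =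
  real_complex R (sqnorm z ^+ j * expR (- pi * sqnorm z) * \1_(disc rho) z).
Proof.
have zz : plane_to_C z * conjc (plane_to_C z) = real_complex R (sqnorm z).
  by rewrite /sqnorm; apply/eqP; rewrite eq_complex /=; apply/andP; split; apply/eqP; ring.
rewrite /mode_prod /mode.
have cM (x y : R[i]) : conjc (x * y) = conjc x * conjc y by rewrite rmorphM.
have cX (x : R[i]) : conjc (x ^+ j) = conjc x ^+ j by rewrite rmorphXn.
rewrite cM cX.
have -> : (conjc (real_complex R (expR (- (pi / 2) * sqnorm z) * \1_(disc rho) z))) =
    real_complex R (expR (- (pi / 2) * sqnorm z) * \1_(disc rho) z) by exact: conjc_real.
rewrite mulrACA -exprMn zz -rmorphXn -rmorphM -rmorphM; congr (real_complex R _).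
rewrite -mulrA; congr (_ * _).
have -> : expR (- pi * sqnorm z) = expR (- (pi / 2) * sqnorm z) * expR (- (pi / 2) * sqnorm z).
  by rewrite -expRD; congr expR; field.
have i2 : \1_(disc rho) z * \1_(disc rho) z = \1_(disc rho) z :> R.
  by rewrite indicE; case: (_ \in _); rewrite ?mulr0 ?mulr1.
by rewrite -{3}i2; ring.
Qed.

Lemma mode_gram j l : real_complex R (mode_weight j) * cintegral lambda2 (mode_prod rho j l) =
  if j == l then real_complex R (disc_eigenvalue j) else 0.
Proof.
case: eqVneq => [<-|jl]; last by rewrite mode_orthogonal // mulr0.
rewrite -cintegralZ; last exact: mode_prod_integrable.
rewrite /cintegral /disc_eigenvalue; congr Complex.
  by apply: eq_Rintegral => z _; rewrite mode_prodjj -rmorphM.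
under eq_Rintegral do rewrite mode_prodjj -rmorphM /=.
by rewrite /Rintegral integral0.
Qed.

Let radial j (a : R) (z : plane) := sqnorm z ^+ j * expR (- a * sqnorm z).

Let radial_ge0 j a z : 0 <= radial j a z.
Proof. by rewrite mulr_ge0 ?expR_ge0 // exprn_ge0 // sqnorm_ge0. Qed.

Let measurable_radial j a : measurable_fun setT (radial j a).
Proof. exact: measurable_sqnorm_gauss. Qed.

Let integrable_radial j (a : R) : 0 < a -> lambda2.-integrable setT (EFin \o radial j a).
Proof.
move=> a0; apply/integrableP; split; first exact/measurable_EFinP.
rewrite (eq_integral (fun z => (radial j a z)%:E)); last first.
  by move=> z _; rewrite gee0_abs // lee_fin.
by rewrite (gauss_moment j a0) ltry.
Qed.

Let integral_radial j (a : R) : 0 < a -> \int[lambda2]_z radial j a z = pi * j`!%:R / a ^+ j.+1.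
Proof. by move=> a0; rewrite /Rintegral (gauss_moment j a0). Qed.

Let ind01 (x : plane) : ((0 : R) <= \1_(disc rho) x) && (\1_(disc rho) x <= (1 : R)).
Proof. by rewrite indicE ler0n lern1; case: (_ \in _). Qed.

Let integrable_radial_disc j : lambda2.-integrable setT (EFin \o (fun z => radial j pi z * \1_(disc rho) z)).
Proof.
apply: (le_integrable _ _ _ (integrable_radial j (pi_gt0 R))) => //.
  apply/measurable_EFinP; apply: measurable_funM => //.
  by apply: measurable_indic; exact: measurable_disc.
move=> z _ /=; have /andP[i0 i1] := ind01 z.
rewrite lee_fin (ger0_norm (mulr_ge0 (radial_ge0 j pi z) i0)) (ger0_norm (radial_ge0 j pi z)).
exact: ler_piMr.
Qed.

Lemma disc_eigenvalueE j :
  disc_eigenvalue j = mode_weight j * \int[lambda2]_z (radial j pi z * \1_(disc rho) z).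
Proof. by rewrite /disc_eigenvalue RintegralZl //; exact: integrable_radial_disc. Qed.

Lemma disc_eigenvalue_ge0 j : 0 <= disc_eigenvalue j.
Proof.
rewrite disc_eigenvalueE mulr_ge0 ?mode_weight_ge0 //.
apply: Rintegral_ge0 => z _; apply: mulr_ge0; first exact: radial_ge0.
by case/andP: (ind01 z).
Qed.

Let pi0 : pi != 0 :> R. Proof. by rewrite gt_eqF // pi_gt0. Qed.
Let fact0 j : j`!%:R != 0 :> R.
Proof. by rewrite pnatr_eq0 -lt0n fact_gt0. Qed.

Lemma mode_weight_total j : mode_weight j * \int[lambda2]_z radial j pi z = 1.
Proof.
rewrite integral_radial ?pi_gt0 // /mode_weight exprS.
have pij : pi ^+ j != 0 :> R by rewrite expf_neq0.
move: (pi : R) pi0 pij => p p0 pij.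
by field; rewrite p0 fact0 pij.
Qed.

Lemma disc_eigenvalue_le1 j : disc_eigenvalue j <= 1.
Proof.
rewrite disc_eigenvalueE -(mode_weight_total j) ler_wpM2l ?mode_weight_ge0 //.
apply: le_Rintegral => //; first exact/integrable_radial/pi_gt0.
by move=> z _; rewrite ler_piMr // indicE; case: (_ \in _).
Qed.

(** Chernoff's bound: off the disc, 1 is at most [expR (pi / 2 * (sqnorm z -
    rho ^+ 2))], and the resulting Gaussian moment is explicit. *)
Lemma disc_eigenvalue_complement_le j :
  1 - disc_eigenvalue j <= 2 ^+ j.+1 * expR (- (pi / 2) * rho ^+ 2).
Proof.
have p2 : 0 < pi / 2 :> R by rewrite divr_gt0 // pi_gt0.
rewrite -[X in X - _](mode_weight_total j) disc_eigenvalueE -mulrBr -RintegralB //; last exact/integrable_radial/pi_gt0.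
have -> : 2 ^+ j.+1 * expR (- (pi / 2) * rho ^+ 2) = mode_weight j *
    (expR (- (pi / 2) * rho ^+ 2) * \int[lambda2]_z radial j (pi / 2) z).
  rewrite integral_radial // /mode_weight expr_div_n.
  have pij : pi ^+ j.+1 != 0 :> R by rewrite expf_neq0.
  have -> : pi ^+ j / j`!%:R = pi ^+ j.+1 / pi / j`!%:R :> R by rewrite exprSr mulfK.
  have t2 : (2 : R) ^+ j.+1 != 0 by rewrite expf_neq0.
  move: (pi : R) pi0 pij => p p0 pij.
  by field; rewrite p0 fact0 pij t2.
apply: ler_wpM2l; first exact: mode_weight_ge0.
have ig := integrable_radial j p2.
rewrite -RintegralZl //.
apply: le_Rintegral => //.
- exact: (integrableB _ (integrable_radial j (pi_gt0 R)) (integrable_radial_disc j)).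
- exact: (integrableZl _ _ ig).
move=> z _; rewrite /radial [leRHS]mulrCA.
have [zD|zD] := pselect (disc rho z).
  by rewrite indic_in // mulr1 subrr !mulr_ge0 ?expR_ge0 // exprn_ge0 // sqnorm_ge0.
rewrite indic_out // mulr0 subr0 ler_wpM2l ?exprn_ge0 ?sqnorm_ge0 //.
rewrite -expRD ler_expR.
have : rho ^+ 2 <= sqnorm z by apply: ltW; rewrite ltNge; apply/negP.
move=> h; have : 0 <= (pi / 2) * (sqnorm z - rho ^+ 2) by rewrite mulr_ge0 ?subr_ge0 // ltW.
lra.
Qed.

(** The truncated kernel is at most 1 on the diagonal. *)
Lemma sum_disc_eigenvalue_le M :
  \sum_(j < M) disc_eigenvalue j <= fine (lambda2 (disc rho)).
Proof.
pose D := disc rho; have mD : measurable D := measurable_disc rho.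
have i1 : lambda2.-integrable setT (EFin \o \1_D).
  apply/integrableP; split; first exact/measurable_EFinP.
  rewrite (eq_integral (fun z => (\1_D z)%:E)); last by move=> z _; rewrite gee0_abs // lee_fin.
  by rewrite integral_indic // setIT; exact: disc_area_lty.
have -> : fine (lambda2 D) = \int[lambda2]_z (\1_D z).
  by rewrite /Rintegral integral_indic // setIT.
have -> : \sum_(j < M) disc_eigenvalue j =
    \int[lambda2]_z (\sum_(j < M) mode_weight j * (radial j pi z * \1_D z)).
  rewrite /disc_eigenvalue /Rintegral.
  under [in RHS]eq_integral do rewrite -sumEFin.
  rewrite integral_sum //; last by move=> j; exact: (integrableZl _ _ (integrable_radial_disc j)).
  rewrite sum_fine // => j _; apply: integrable_fin_num => //.
  exact: (integrableZl _ _ (integrable_radial_disc j)).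
apply: le_Rintegral => //.
  rewrite (_ : _ \o _ = fun z => (\sum_(j < M) (mode_weight j * (radial j pi z * \1_D z))%:E)%E).
    by apply: integrable_sum => // j _; exact: (integrableZl _ _ (integrable_radial_disc j)).
  by apply/funext => z /=; rewrite sumEFin.
move=> z _.
have -> : \sum_(j < M) mode_weight j * (radial j pi z * \1_D z) =
    exp_sum M (pi * sqnorm z) * expR (- pi * sqnorm z) * \1_D z.
  rewrite /exp_sum big_mkord !mulr_suml; apply: eq_bigr => j _.
  by rewrite /mode_weight /radial exprMn; ring.
rewrite ler_piMl // mulNr expRN ler_pdivrMr ?expR_gt0 // mul1r.
by rewrite exp_sum_le_expR // mulr_ge0 ?pi_ge0 // sqnorm_ge0.
Qed.

End eigenvalues.

(** * Factorial moments of the number of points in a disc *)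

Section ginibre_moments.
Context {R : realType}.
Local Notation plane := (plane R).
Local Notation lambda2 := (@plane_lebesgue R).
Local Notation "x %:C" := (real_complex R x) (at level 1, format "x %:C").
Variables (a : plane) (rho : R).

Definition recentre (z : plane) : plane := (z.1 - a.1, z.2 - a.2).

Definition disc_at : set plane := recentre @^-1` disc rho.

Lemma indic_disc_at z : \1_disc_at z = \1_(disc rho) (recentre z) :> R.
Proof. by rewrite !indicE; congr (_%:R); apply/idP/idP => /set_mem ?; apply/mem_set. Qed.

(** The factor of modulus 1 by which the kernel fails to be translation
    invariant; it cancels in determinants. *)
Definition phase (z : plane) : R[i] :=
  expC (Complex 0 (pi * (a.1 * (z.2 - a.2) - a.2 * (z.1 - a.1)))).

Definition shifted_mode (j : nat) (z : plane) : R[i] :=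
  phase z * mode rho j (recentre z).

Lemma area_preserving_recentre : area_preserving recentre.
Proof. exact: (area_preserving_translation (- a.1, - a.2)). Qed.

Lemma measurable_disc_at : measurable disc_at.
Proof.
rewrite -[X in measurable X]setTI; apply: area_preserving_recentre.1 => //.
exact: measurable_disc.
Qed.

Lemma phase_unit z : phase z * conjc (phase z) = 1.
Proof.
rewrite /phase -expC_conj -expCD -[RHS]expC0; congr expC.
by apply/eqP; rewrite eq_complex /=; apply/andP; split; apply/eqP; ring.
Qed.

Lemma normc_phase z : normc (phase z) = 1.
Proof.
rewrite /phase /expC expR0 normcM normc_real normr1 mul1r /=.
by rewrite cos2Dsin2 sqrtr1.
Qed.

Lemma exp_mode_pair (b c : plane) :
  ginibre_kernel (plane_to_C b) (plane_to_C c) =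
  (expR (- (pi / 2) * sqnorm b))%:C * (expR (- (pi / 2) * sqnorm c))%:C *
  expC (pi%:C * plane_to_C b * conjc (plane_to_C c)).
Proof.
rewrite -!expC_real -!expCD; congr expC.
rewrite -!add_Re2_Im2 -(rmorph_nat (real_complex R) 2) -fmorphV.
apply/eqP; rewrite eq_complex /= /sqnorm.
by move: (pi : R) (2^-1 : R) => p h; apply/andP; split; apply/eqP; ring.
Qed.

Lemma ginibre_kernel_recentre (z w : plane) :
  ginibre_kernel (plane_to_C z) (plane_to_C w) =
  phase z * conjc (phase w) *
  ginibre_kernel (plane_to_C (recentre z)) (plane_to_C (recentre w)).
Proof.
rewrite /phase -expC_conj /ginibre_kernel -!expCD; congr expC.
rewrite -!add_Re2_Im2.
rewrite -(rmorph_nat (real_complex R) 2) -fmorphV.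
have two : (1 : R) = 2 * 2^-1 by rewrite divff.
apply/eqP; rewrite eq_complex /=.
by move: (pi : R) => p; apply/andP; split; apply/eqP; field.
Qed.

(** The Ginibre kernel restricted to the disc, with its exponential series
    truncated. *)
Definition truncated_kernel (M : nat) (z w : plane) : R[i] :=
  \sum_(j < M) ((mode_weight j)%:C * shifted_mode j z) * conjc (shifted_mode j w).

Lemma truncated_kernelE M z w : truncated_kernel M z w =
  phase z * conjc (phase w) *
  ((expR (- (pi / 2) * sqnorm (recentre z)) * \1_(disc rho) (recentre z))%:C *
   (expR (- (pi / 2) * sqnorm (recentre w)) * \1_(disc rho) (recentre w))%:C) *
  exp_sum M (pi%:C * plane_to_C (recentre z) * conjc (plane_to_C (recentre w))).
Proof.
rewrite /truncated_kernel /exp_sum big_mkord mulr_sumr; apply: eq_bigr => j _.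
have cM (x y : R[i]) : conjc (x * y) = conjc x * conjc y by rewrite rmorphM.
have cX (x : R[i]) : conjc (x ^+ j) = conjc x ^+ j by rewrite rmorphXn.
have -> : (mode_weight j)%:C = pi%:C ^+ j / j`!%:R.
  by rewrite /mode_weight rmorphM rmorphXn fmorphV rmorph_nat.
rewrite /shifted_mode (cM (phase w)) /mode (cM (_ ^+ j)) cX conjc_real !exprMn.
by move: (pi%:C) => p; ring.
Qed.

Lemma truncated_kernel_cvg z w : cvg_complex (fun M => truncated_kernel M z w)
  (ginibre_kernel (plane_to_C z) (plane_to_C w) *
   (\1_disc_at z * \1_disc_at w)%:C).
Proof.
under eq_fun do rewrite truncated_kernelE.
rewrite ginibre_kernel_recentre exp_mode_pair.
set b := recentre z; set c := recentre w.
rewrite [X in cvg_complex _ X](_ : _ = phase z * conjc (phase w) *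
  ((expR (- (pi / 2) * sqnorm b) * \1_(disc rho) b)%:C *
   (expR (- (pi / 2) * sqnorm c) * \1_(disc rho) c)%:C) *
  expC (pi%:C * plane_to_C b * conjc (plane_to_C c))).
  by apply: cvg_complexM; [exact: cvg_complex_cst|exact: exp_sum_cvg].
have -> : \1_disc_at z = \1_(disc rho) b :> R by exact: indic_disc_at.
have -> : \1_disc_at w = \1_(disc rho) c :> R by exact: indic_disc_at.
by rewrite !rmorphM; ring.
Qed.

(** The modulus is at most exp (- pi (|b| - |c|) ^ 2 / 2), where [b] and [c]
    are the two points seen from the centre of the disc. *)
Lemma truncated_kernel_bound M z w :
  normc (truncated_kernel M z w) <= \1_disc_at z.
Proof.
have -> : \1_disc_at z = \1_(disc rho) (recentre z) :> R by exact: indic_disc_at.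
rewrite truncated_kernelE; move: (normc_phase z) (normc_phase w).
move: (phase z) (phase w) => p q hp hq.
rewrite !normcM normc_conj hp hq !mul1r !normc_real.
set b := recentre z; set c := recentre w.
have ind01 (x : plane) : (0 : R) <= \1_(disc rho) x /\ \1_(disc rho) x <= (1 : R).
  by rewrite indicE ler0n lern1; split=> //; case: (_ \in _).
have [b0 b1] := ind01 b; have [c0 c1] := ind01 c.
rewrite !ger0_norm ?mulr_ge0 ?expR_ge0 //.
set E := normc _.
have hE : expR (- (pi / 2) * sqnorm b) * expR (- (pi / 2) * sqnorm c) * E <= 1.
  apply: (@le_trans _ _ (expR (- (pi / 2) * sqnorm b) * expR (- (pi / 2) * sqnorm c) *
    expR (pi * Num.sqrt (sqnorm b) * Num.sqrt (sqnorm c)))).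
    rewrite ler_wpM2l ?mulr_ge0 ?expR_ge0 //.
    apply: le_trans (exp_sum_normc _ _) _.
    rewrite !normcM normc_conj normc_real !normc_plane ger0_norm ?pi_ge0 //.
    by apply: exp_sum_le_expR; rewrite !mulr_ge0 ?pi_ge0 ?sqrtr_ge0.
  rewrite -!expRD -[leRHS]expR0 ler_expR.
  have hb : sqnorm b = Num.sqrt (sqnorm b) ^+ 2 by rewrite sqr_sqrtr ?sqnorm_ge0.
  have hc : sqnorm c = Num.sqrt (sqnorm c) ^+ 2 by rewrite sqr_sqrtr ?sqnorm_ge0.
  move: hb hc; set x := Num.sqrt _; set y := Num.sqrt (sqnorm c).
  clearbody x y => -> ->.
  have := mulr_ge0 (pi_ge0 R) (sqr_ge0 (x - y)); move: (pi : R) => p0.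
  rewrite sqrrB; lra.
rewrite [leLHS](_ : _ = \1_(disc rho) b * (\1_(disc rho) c *
  (expR (- (pi / 2) * sqnorm b) * expR (- (pi / 2) * sqnorm c) * E))); last by ring.
rewrite ler_piMr // mulr_ile1 ?mulr_ge0 ?expR_ge0 //.
exact: normc_ge0.
Qed.

Definition mode_left (j : nat) z := (mode_weight j)%:C * shifted_mode j z.
Definition mode_right (j : nat) z := conjc (shifted_mode j z).

Lemma mode_left_right j l z :
  mode_left j z * mode_right l z = (mode_weight j)%:C * mode_prod rho j l (recentre z).
Proof.
rewrite /mode_left /mode_right /shifted_mode /mode_prod.
have cM (x y : R[i]) : conjc (x * y) = conjc x * conjc y by rewrite rmorphM.
by rewrite cM -[RHS]mulr1 -(phase_unit z); ring.
Qed.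

Lemma mode_left_right_integrable j l :
  cintegrable lambda2 (fun z => mode_left j z * mode_right l z).
Proof.
rewrite (_ : (fun z => _) = (fun z => (mode_weight j)%:C * mode_prod rho j l (recentre z))).
  apply: cintegrableZ.
  have [mr hr] := area_preserving_recentre.
  have [i1 i2] := mode_prod_integrable rho j l.
  have key (f : plane -> R) : lambda2.-integrable setT (EFin \o f) ->
      lambda2.-integrable setT (EFin \o (fun z => f (recentre z))).
    move=> /integrableP[mf ff]; apply/integrableP; split.
      exact: (measurableT_comp mf mr).
    rewrite -(hr (fun z => `|(EFin \o f) z|%E)) // in ff.
    exact: measurableT_comp.
  split; [exact: (key _ i1)|exact: (key _ i2)].
by apply/funext => z; exact: mode_left_right.
Qed.

Lemma mode_left_right_cintegral j l :
  cintegral lambda2 (fun z => mode_left j z * mode_right l z) =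
  if j == l then (disc_eigenvalue rho j)%:C else 0.
Proof.
rewrite -mode_gram -cintegralZ; last exact: mode_prod_integrable.
rewrite -[RHS](cintegral_area_preserving area_preserving_recentre); last first.
  by apply: cintegrableZ; exact: mode_prod_integrable.
by congr cintegral; apply/funext => z; exact: mode_left_right.
Qed.

(** The Gram matrix of the modes is diagonal, so only injective choices of
    modes contribute. *)
Lemma truncated_det_integral k M :
  let F := fun t : k.-tuple plane =>
    \det (\matrix_(i < k, l < k) truncated_kernel M (tnth t i) (tnth t l)) in
  cintegrable (tuple_measure plane_lebesgue k) F /\
  cintegral (tuple_measure plane_lebesgue k) F =
  (\sum_(J : {ffun 'I_k -> 'I_M} | injectiveb J)
    \prod_(i < k) disc_eigenvalue rho (J i))%:C.
Proof.
have [h1 h2] := cintegral_det k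
  (fun (j l : 'I_M) => mode_left_right_integrable j l).
split; first exact: h1.
rewrite [LHS]h2 rmorph_sum [RHS]big_mkcond /=; apply: eq_bigr => J _.
transitivity (\det (\matrix_(i < k, l < k)
  (if J i == J l then (disc_eigenvalue rho (J i))%:C else 0))).
  congr (\det _); apply/matrixP => i l; rewrite !mxE.
  exact: mode_left_right_cintegral.
rewrite (det_diagonal_gram (fun j : 'I_M => (disc_eigenvalue rho j)%:C) J).
by case: ifP => // _; rewrite rmorph_prod.
Qed.

Definition disc_tuples k : set (k.-tuple plane) :=
  [set t | forall i, disc_at (tnth t i)].

Arguments disc_tuples : clear implicits.

Lemma measurable_disc_tuples k : measurable (disc_tuples k).
Proof.
rewrite (_ : disc_tuples k = \bigcap_(i in [set: 'I_k]) ((fun t => tnth t i) @^-1` disc_at)).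
  apply: fin_bigcap_measurable => // i _.
  rewrite -[X in measurable X]setTI; apply: measurable_tnth => //.
  exact: measurable_disc_at.
apply/seteqP; split => t /= h i; first by move=> _; exact: h.
exact: (h i).
Qed.

Lemma indic_disc_tuples k t :
  \1_(disc_tuples k) t = \prod_(i < k) \1_disc_at (tnth t i) :> R.
Proof.
have [h|h] := pselect (disc_tuples k t).
  by rewrite indic_in // big1 // => i _; rewrite indic_in.
rewrite indic_out //.
have [i hi] : exists i, ~ disc_at (tnth t i) by apply/existsNP.
by rewrite (bigD1 i) //= indic_out // mul0r.
Qed.

End ginibre_moments.

Lemma det_rescale (F : comPzRingType) k (A : 'I_k -> 'I_k -> F) (x : 'I_k -> F) :
  \det (\matrix_(i < k, l < k) (A i l * (x i * x l))) =
  \det (\matrix_(i < k, l < k) A i l) * (\prod_i x i * \prod_i x i).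
Proof.
rewrite /determinant mulr_suml; apply: eq_bigr => s _.
rewrite -mulrA; congr (_ * _).
under eq_bigr do rewrite mxE; under [in RHS]eq_bigr do rewrite mxE.
rewrite !big_split /=; congr (_ * (_ * _)).
by rewrite [RHS](reindex_inj (@perm_inj _ s)).
Qed.

Section moment_limit.
Context {R : realType}.
Local Notation plane := (plane R).
Local Notation "x %:C" := (real_complex R x) (at level 1, format "x %:C").
Variables (a : plane) (rho : R) (k : nat).
Local Notation nu := (tuple_measure (@plane_lebesgue R) k).

Lemma integrable_disc_tuples (c : R) :
  nu.-integrable setT (EFin \o (fun t => c * \1_(@disc_tuples R a rho k) t)).
Proof.
have id : cintegrable (@plane_lebesgue R) (fun z => (\1_(disc_at a rho) z)%:C).
  have [m1 m2] := area_preserving_recentre a.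
  have mD := measurable_disc_at a rho.
  split => /=; last exact: integrable0.
  apply/integrableP; split; first by apply/measurable_EFinP; exact: measurable_indic.
  rewrite (eq_integral (fun z => (\1_(disc_at a rho) z)%:E)); last first.
    by move=> z _; rewrite gee0_abs // lee_fin.
  rewrite (eq_integral (fun z => (\1_(disc rho) (recentre a z))%:E)); last first.
    by move=> z _; rewrite indic_disc_at.
  rewrite (m2 (fun z => (\1_(disc rho) z)%:E)).
    have mr := measurable_disc rho.
    by rewrite integral_indic // setIT; exact: disc_area_lty.
  by apply/measurable_EFinP; apply: measurable_indic; exact: (measurable_disc rho).
have [[i1 _] _] := cintegral_tuple (fun i : 'I_k => id).
have i2 : nu.-integrable setT (EFin \o \1_(@disc_tuples R a rho k)).
  move: i1; congr (_.-integrable _ (EFin \o _)).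
  by apply/funext => t; rewrite indic_disc_tuples -rmorph_prod.
exact: (integrableZl _ c i2).
Qed.

Lemma normc_truncated_det M (t : k.-tuple plane) :
  normc (\det (\matrix_(i < k, l < k) truncated_kernel a rho M (tnth t i) (tnth t l)))
  <= k`!%:R * \1_(@disc_tuples R a rho k) t.
Proof.
apply: le_trans (normc_sum _ _ _) _.
have -> : k`!%:R * \1_(@disc_tuples R a rho k) t =
    \sum_(s : 'S_k) \1_(@disc_tuples R a rho k) t :> R.
  by rewrite sumr_const card_Sn mulr_natl.
apply: ler_sum => s _; rewrite normcM normcX normcN normc1 expr1n mul1r.
rewrite normc_prod indic_disc_tuples; apply: ler_prod => i _.
by rewrite mxE normc_ge0 truncated_kernel_bound.
Qed.

(** Dominated convergence: every entry of the matrix tends to the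
    corresponding value of the kernel on the disc, and all truncated
    determinants are at most [k`!] in modulus and vanish unless all points are
    in the disc. *)
Lemma disc_moment_cvg (f : k.-tuple plane -> R) :
  measurable_fun setT f -> (forall t, 0 <= f t) ->
  (forall t : k.-tuple plane, (f t)%:C = \det (\matrix_(i < k, l < k)
     ginibre_kernel (plane_to_C (tnth t i)) (plane_to_C (tnth t l)))) ->
  (\int[nu]_(t in @disc_tuples R a rho k) (f t)%:E)%E \is a fin_num /\
  \sum_(J : {ffun 'I_k -> 'I_M} | injectiveb J)
     \prod_(i < k) disc_eigenvalue rho (J i) @[M --> \oo] -->
  fine (\int[nu]_(t in @disc_tuples R a rho k) (f t)%:E)%E.
Proof.
move=> mf f0 fE.
pose B := @disc_tuples R a rho k; have mB : measurable B := measurable_disc_tuples a rho (k := k).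
pose u M (t : k.-tuple plane) :=
  \det (\matrix_(i < k, l < k) truncated_kernel a rho M (tnth t i) (tnth t l)).
have uf t : cvg_complex (fun M => u M t) ((f t * \1_B t)%:C).
  have -> : (f t * \1_B t)%:C = \det (\matrix_(i < k, l < k)
      (ginibre_kernel (plane_to_C (tnth t i)) (plane_to_C (tnth t l)) *
       ((\1_(disc_at a rho) (tnth t i))%:C * (\1_(disc_at a rho) (tnth t l))%:C))).
    have P : \prod_i (\1_(disc_at a rho) (tnth t i))%:C = (\1_B t)%:C.
      by rewrite indic_disc_tuples rmorph_prod.
    rewrite (det_rescale _ (fun i => (\1_(disc_at a rho) (tnth t i))%:C)) P -fE -!rmorphM.
    congr (real_complex R (_ * _)).
    by rewrite -/B indicE; case: (_ \in _); rewrite ?mulr0 ?mulr1.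
  apply: cvg_complex_det => i l; rewrite !mxE -rmorphM.
  under eq_fun do rewrite mxE.
  exact: truncated_kernel_cvg.
have intu M := (truncated_det_integral a rho k M).1.
have Eu M := (truncated_det_integral a rho k M).2.
have [] := @dominated_convergence _ _ _ nu setT measurableT
  (fun M t => (complex.Re (u M t))%:E) (fun t => (f t * \1_B t)%:E)
  (EFin \o (fun t => k`!%:R * \1_B t)).
- by move=> M; exact: (measurable_int _ (intu M).1).
- by apply/measurable_EFinP; apply: measurable_funM => //; exact: measurable_indic.
- apply: aeW => t _; apply: cvg_EFin; first exact: nearW.
  exact: (uf t).1.
- exact: integrable_disc_tuples.
- apply: aeW => t M _ /=; rewrite lee_fin.
  exact: le_trans (Re_le_normc _) (normc_truncated_det _ _).
move=> ifB _ cvgI.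
have -> : (\int[nu]_(t in B) (f t)%:E = \int[nu]_t (f t * \1_B t)%:E)%E.
  rewrite integral_mkcond; apply: eq_integral => t _.
  rewrite patchE indicE; case: (_ \in _); by rewrite ?mulr1 ?mulr0.
have fin : (\int[nu]_t (f t * \1_B t)%:E)%E \is a fin_num by exact: (integrable_fin_num measurableT ifB).
split=> //.
rewrite -(fineK fin) in cvgI.
apply: (cvg_trans _ (fine_cvg cvgI)); apply: near_eq_cvg; apply: nearW => M.
by have /(congr1 (@complex.Re R)) /= := Eu M.
Qed.
End moment_limit.

(** * Alternating sums of elementary symmetric functions *)

Section elementary_symmetric.
Variable R : realFieldType.
Variable x : nat -> R.

(** This is [k`!] times the elementary symmetric function of degree [k], in
    the form in which the integral of a determinant produces it. *)
Definition injective_sum (k M : nat) : R :=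
  \sum_(J : {ffun 'I_k -> 'I_M} | injectiveb J) \prod_(i < k) x (J i).

Definition esym (k M : nat) : R := (\prod_(j < M) (1 + x j *: 'X : {poly R}))`_k.

Lemma esym_subsets k M :
  esym k M = \sum_(A : {set 'I_M} | #|A| == k) \prod_(j in A) x j.
Proof.
rewrite /esym; under eq_bigr do rewrite addrC.
rewrite bigA_distr /= coef_sum [RHS]big_mkcond /=; apply: eq_bigr => A _.
rewrite -big_mkcond /= (eq_bigr (fun j : 'I_M => (x j)%:P * 'X)); last first.
  by move=> j _; rewrite mul_polyC.
rewrite big_split /= prodr_const -rmorph_prod /= coefCM coefXn eq_sym.
by case: eqP; rewrite ?mulr1 ?mulr0.
Qed.

Lemma injective_sum_esym k M : injective_sum k M = k`!%:R * esym k M.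
Proof.
rewrite esym_subsets mulr_sumr /injective_sum.
rewrite (partition_big (fun J : {ffun 'I_k -> 'I_M} => [set J i | i : 'I_k]%SET)
  (fun A : {set 'I_M} => #|A| == k)) /=; last first.
  by move=> J /injectiveP Ji; rewrite card_imset // card_ord.
apply: eq_bigr => A /eqP cA.
rewrite (eq_bigr (fun=> \prod_(j in A) x j)); last first.
  move=> J /andP[/injectiveP Ji /eqP <-].
  by rewrite big_imset /=; [apply: eq_bigl => i; rewrite inE|move=> i l _ _; exact: Ji].
rewrite sumr_const -[LHS]mulr_natl; congr (_ * _); congr (_%:R).
rewrite -(ffactnn k) -[X in _ = (X ^_ _)%N]cA -[X in _ = (_ ^_ X)%N](card_ord k) -card_inj_ffuns_on.
apply: eq_card => J; rewrite !inE unfold_in /= andbC.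
have [/injectiveP Ji|] := boolP (injectiveb J); last by rewrite !andbF.
rewrite !andbT eqEcard card_imset // card_ord cA leqnn andbT.
apply/fintype.subsetP/ffun_onP => [h i|h j /imsetP[i _ ->]].
  by apply: h; apply: imset_f.
exact: h.
Qed.

Lemma esym0 M : esym 0 M = 1.
Proof.
rewrite esym_subsets (big_pred1 finset.set0) => [|A]; last by rewrite cards_eq0.
by rewrite finset.big_set0.
Qed.

Lemma esymS k M : esym k.+1 M.+1 = esym k.+1 M + x M * esym k M.
Proof.
rewrite /esym big_ord_recr /= mulrDr mulr1 coefD; congr (_ + _).
by rewrite -scalerAr coefZ coefMX.
Qed.

Hypothesis x01 : forall j, 0 <= x j <= 1.

Lemma esym_ge0 k M : 0 <= esym k M.
Proof.
rewrite esym_subsets; apply: sumr_ge0 => A _; apply: prodr_ge0 => j _.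
by case/andP: (x01 j).
Qed.

Lemma esym_le k M : esym k M <= (\sum_(j < M) x j) ^+ k / k`!%:R.
Proof.
rewrite ler_pdivlMr ?ltr0n ?fact_gt0 // mulrC -injective_sum_esym.
rewrite -[X in _ <= _ ^+ X](card_ord k) -prodr_const bigA_distr_bigA /=.
rewrite /injective_sum big_mkcond /=; apply: ler_sum => J _.
case: ifP => // _; apply: prodr_ge0 => i _.
by case/andP: (x01 (J i)).
Qed.

(** Bonferroni's inequality for independent events of probabilities [x j].
    Adding a variable [x] turns an even partial sum T into (1 - x) T plus x
    times its last term. *)
Lemma alternating_esym m M :
  \sum_(k < m.*2.+1) (-1) ^+ k * esym k M <=
  \prod_(j < M) (1 - x j) + esym m.*2.+1 M.
Proof.
elim: M => [|M IHM].
  rewrite big_ord0 big_ord_recl /= expr0 mul1r esym0 big1 ?addr0 ?lerDl ?esym_ge0 // => i _.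
  by rewrite /esym big_ord0 coef1 mulr0.
pose T K := \sum_(k < K) (-1) ^+ k * esym k M.
have TS : \sum_(k < m.*2.+1) (-1) ^+ k * esym k M.+1 =
    (1 - x M) * T m.*2.+1 + x M * esym m.*2 M.
  have -> : \sum_(k < m.*2.+1) (-1) ^+ k * esym k M.+1 = T m.*2.+1 - x M * T m.*2.
    rewrite /T big_ord_recl [X in _ = X - _]big_ord_recl /= !esym0 -addrA; congr (_ + _).
    rewrite mulr_sumr -sumrB; apply: eq_bigr => i _.
    by rewrite esymS exprS; ring.
  have -> : T m.*2.+1 = T m.*2 + esym m.*2 M.
    by rewrite /T big_ord_recr /= -[X in X * _]signr_odd odd_double expr0 mul1r.
  ring.
rewrite TS esymS big_ord_recr /=.
have /andP[x0 x1] := x01 M.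
have h : (1 - x M) * T m.*2.+1 <= (1 - x M) * (\prod_(j < M) (1 - x j) + esym m.*2.+1 M).
  by apply: ler_wpM2l => //; rewrite subr_ge0.
have h2 := mulr_ge0 x0 (esym_ge0 m.*2.+1 M).
lra.
Qed.

Lemma alternating_injective_sum m M :
  \sum_(k < m.*2.+1) (-1) ^+ k * (injective_sum k M / k`!%:R) <=
  \prod_(j < M) (1 - x j) + (\sum_(j < M) x j) ^+ m.*2.+1 / m.*2.+1`!%:R.
Proof.
apply: le_trans (lerD (lexx _) (esym_le m.*2.+1 M)).
apply: le_trans (alternating_esym m M).
apply: ler_sum => k _; rewrite injective_sum_esym mulrAC divff ?mul1r //.
Qed.

Lemma prod_complement_le J M : (J <= M)%N ->
  \prod_(j < M) (1 - x j) <= \prod_(j < J) (1 - x j).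
Proof.
move=> /subnKC <-; elim: (M - J)%N => [|n IHn]; first by rewrite addn0.
rewrite addnS big_ord_recr /=; apply: le_trans IHn.
have /andP[h0 h1] := x01 (J + n).
rewrite ler_piMr //; last by lra.
by apply: prodr_ge0 => j _; have /andP[] := x01 j; lra.
Qed.

End elementary_symmetric.

Lemma alternating_binomial (R : numDomainType) N K :
  \sum_(k < K.+1) (-1) ^+ k * 'C(N.+1, k)%:R = (-1) ^+ K * 'C(N, K)%:R :> R.
Proof.
elim: K => [|K IHK]; first by rewrite big_ord1 !expr0 !bin0.
by rewrite big_ord_recr /= IHK binS natrD exprS; ring.
Qed.

(** For a positive number of points the alternating sum is a single binomial
    coefficient. *)
Lemma indicator_le_alternating (R : numDomainType) N m :
  (N == 0%N)%:R <= \sum_(k < m.*2.+1) (-1) ^+ k * 'C(N, k)%:R :> R.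
Proof.
case: N => [|N] /=.
  rewrite big_ord_recl /= expr0 bin0 mul1r big1 ?addr0 // => i _.
  by rewrite bin0n /= mulr0.
by rewrite alternating_binomial -signr_odd odd_double expr0 mul1r ler0n.
Qed.

(** * Void probabilities *)

Section counting_tuples.
Context {R : realType} {T : choiceType}.

(** Tuples of points of [A] are tuples over the finite type of elements of
    [A]. *)
Lemma counting_uniq_tuples (A : set T) k : finite_set A ->
  counting [set t : k.-tuple T | uniq t /\ forall i, A (tnth t i)] =
  ((#|` fset_set A| ^_ k)%:R)%:E :> \bar R.
Proof.
move=> fA; set X := fset_set A.
pose g (t : k.-tuple X) : k.-tuple T := map_tuple val t.
have gi : injective g.
  move=> s t /(congr1 val) /= /(inj_map val_inj) st; exact: val_inj.
pose Y : {fset k.-tuple T} := [fset g t | t in [set t : k.-tuple X | uniq t]%SET]%fset.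
have SY : [set t : k.-tuple T | uniq t /\ forall i, A (tnth t i)] = [set` Y].
  apply/seteqP; split => t /=.
    move=> [ut At].
    have tX i : tnth t i \in X by rewrite in_fset_set // mem_set.
    pose s : k.-tuple X := [tuple [` tX i]%fset | i < k].
    have gs : g s = t by apply: eq_from_tnth => i; rewrite tnth_map tnth_mktuple.
    apply/imfsetP; exists s => //=.
    by rewrite inE -(map_inj_uniq val_inj) -[map _ _]/(tval (g s)) gs.
  move=> /imfsetP[s /=]; rewrite inE => us ->; split.
    by rewrite /= map_inj_uniq //; exact: val_inj.
  move=> i; rewrite tnth_map.
  by have := fsvalP (tnth s i); rewrite in_fset_set // => /set_mem.
rewrite SY /counting asboolT // set_fsetK; congr ((_%:R)%:E).
rewrite card_imfset //=; rewrite -cardE [#|` X|]cardfE -(card_uniq_tuples k (predT : pred X)).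
by apply: eq_card => t; rewrite !inE all_predT.
Qed.
End counting_tuples.

Section void_probability.
Context {R : realType}.
Local Notation plane := (plane R).
Context {d : measure_display} {Omega : measurableType d}.
Variables (P : probability Omega R) (Phi : Omega -> set plane).
Hypothesis ginPhi : ginibre P Phi.
Variables (a : plane) (rho : R).
Local Notation D := (disc_at a rho).

Lemma bounded_disc_at : bounded_set D.
Proof.
exists (`|a.1| + `|a.2| + `|rho|); split; first exact: num_real.
move=> M ltM z zD /=; apply: le_trans (ltW ltM).
have h1 : `|z.1 - a.1| <= `|rho|.
  rewrite -!sqrtr_sqr ler_wsqrtr //; apply: le_trans zD.
  by rewrite /sqnorm /= lerDl sqr_ge0.
have h2 : `|z.2 - a.2| <= `|rho|.
  rewrite -!sqrtr_sqr ler_wsqrtr //; apply: le_trans zD.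
  by rewrite /sqnorm /= lerDr sqr_ge0.
have t1 := ler_normD (z.1 - a.1) a.1; rewrite subrK in t1.
have t2 := ler_normD (z.2 - a.2) a.2; rewrite subrK in t2.
have n1 := normr_ge0 a.1; have n2 := normr_ge0 a.2.
rewrite prod_normE ge_max; apply/andP; split; lra.
Qed.

Definition disc_count (w : Omega) : nat := #|` fset_set (Phi w `&` D)|.

Lemma finite_disc_points w : finite_set (Phi w `&` D).
Proof. by case: ginPhi => -[h _] _; exact/h/bounded_disc_at. Qed.

Lemma disc_countE w : point_count Phi D w = ((disc_count w)%:R)%:E.
Proof. by rewrite /point_count /counting asboolT //; exact: finite_disc_points. Qed.

Lemma measurable_disc_count : measurable_fun setT (fun w => (disc_count w)%:R : R).
Proof.
apply/measurable_EFinP.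
have := ginPhi.1.2 D (measurable_disc_at a rho).
by congr measurable_fun; apply/funext => w; rewrite disc_countE.
Qed.

Lemma natr_ffact (n k : nat) : (n ^_ k)%:R = \prod_(i < k) (n%:R - i%:R) :> R.
Proof.
elim: k => [|k IHk]; first by rewrite ffactn0 big_ord0.
rewrite ffactnSr natrM IHk big_ord_recr /=; have [kn|nk] := leqP k n.
  by rewrite natrB.
have -> : \prod_(i < k) (n%:R - i%:R) = 0 :> R.
  by rewrite -IHk ffact_small.
by rewrite !mul0r.
Qed.

Lemma measurable_disc_ffact k : measurable_fun setT (fun w => (disc_count w ^_ k)%:R : R).
Proof.
under eq_fun do rewrite natr_ffact.
elim: k => [|k IHk].
  by under eq_fun do rewrite big_ord0; exact: measurable_cst.
under eq_fun do rewrite big_ord_recr /=.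
apply: measurable_funM => //; apply: measurable_funB => //.
exact: measurable_disc_count.
Qed.

(** For [k = 0] both sides are 1; for positive [k] the moment is the integral
    of the joint intensity. *)
Lemma disc_factorial_moment k :
  P.-integrable setT (EFin \o (fun w => (disc_count w ^_ k)%:R)) /\
  injective_sum (disc_eigenvalue rho) k M @[M --> \oo] -->
  \int[P]_w ((disc_count w ^_ k)%:R).
Proof.
have mk := measurable_disc_ffact k.
have [k0|k1] := posnP k.
  rewrite k0; under eq_fun do rewrite ffactn0.
  split; first exact: finite_measure_integrable_cst.
  rewrite Rintegral_cst // [X in fine X]probability_setT mulr1.
  under eq_fun do rewrite injective_sum_esym esym0 mulr1 fact0.
  exact: cvg_cst.
have [rhok [[mr r0 Er] rE]] := ginPhi.2 k k1.
have [fin cv] := disc_moment_cvg a rho mr r0 rE.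
have E : (\int[P]_w ((disc_count w ^_ k)%:R)%:E =
    \int[tuple_measure plane_lebesgue k]_(t in @disc_tuples R a rho k) (rhok t)%:E)%E.
  rewrite -Er; last exact: measurable_disc_tuples.
  apply: eq_integral => w _; rewrite -counting_uniq_tuples; last exact: finite_disc_points.
  congr counting; apply/seteqP; split => t /=.
      by move=> [ut h]; exact: (conj (conj ut (fun i => (h i).1)) (fun i => (h i).2)).
  by move=> [[ut h1] h2]; exact: (conj ut (fun i => conj (h1 i) (h2 i))).
split; last by rewrite /Rintegral E.
apply/integrableP; split; first exact/measurable_EFinP.
rewrite (eq_integral (fun w => ((disc_count w ^_ k)%:R)%:E)); last first.
  by move=> w _; rewrite gee0_abs // lee_fin.
by rewrite E; move: fin; rewrite fin_numElt => /andP[].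
Qed.

Definition disc_void : set Omega := [set w | disc_count w = 0%N].

Lemma measurable_disc_void : measurable disc_void.
Proof.
have := measurable_disc_count; move=> /(_ measurableT [set 0] (measurable_set1 _)).
rewrite setTI; congr measurable; apply/seteqP; split => w /=.
  by move/eqP; rewrite pnatr_eq0 => /eqP.
by move=> ->.
Qed.

Lemma disc_void_le_alternating m :
  fine (P disc_void) <= \sum_(k < m.*2.+1)
    (-1) ^+ k * (\int[P]_w ((disc_count w ^_ k)%:R) / k`!%:R).
Proof.
pose g k w : R := (-1) ^+ k * ((disc_count w ^_ k)%:R / k`!%:R).
have gE k : g k = (fun w => ((-1) ^+ k / k`!%:R) * (disc_count w ^_ k)%:R).
  by apply/funext => w; rewrite /g; ring.
have ig k : P.-integrable setT (EFin \o g k).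
  by rewrite gE; exact: (integrableZl _ _ (disc_factorial_moment k).1).
have Ig k : \int[P]_w g k w = (-1) ^+ k * (\int[P]_w ((disc_count w ^_ k)%:R) / k`!%:R).
  rewrite gE RintegralZl //; last exact: (disc_factorial_moment k).1.
  by ring.
have isum K : P.-integrable setT (EFin \o (fun w => \sum_(k < K) g k w)) /\
    \int[P]_w (\sum_(k < K) g k w) = \sum_(k < K) \int[P]_w g k w.
  elim: K => [|K [IH1 IH2]].
    under eq_fun do rewrite big_ord0; rewrite big_ord0; split.
      exact: finite_measure_integrable_cst.
    by rewrite Rintegral_cst // mul0r.
  under eq_fun do rewrite big_ord_recr; rewrite big_ord_recr /=; split.
    exact: (integrableD _ IH1 (ig K)).
  by rewrite RintegralD // IH2.
under [leRHS]eq_bigr do rewrite -Ig.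
rewrite -(isum _).2.
have mV := measurable_disc_void.
have -> : fine (P disc_void) = \int[P]_w (\1_disc_void w).
  by rewrite /Rintegral integral_indic // setIT.
apply: le_Rintegral => //.
- exact: integrable_indic.
- exact: (isum _).1.
move=> w _.
have -> : \1_disc_void w = (disc_count w == 0%N)%:R :> R.
  by rewrite indicE; congr (_%:R); congr nat_of_bool; apply/idP/eqP => [/set_mem//|h]; exact/mem_set.
apply: le_trans (indicator_le_alternating R (disc_count w) m) _.
apply: ler_sum => k _; rewrite /g -bin_ffact natrM mulfK //.
Qed.

(** The remainder in Bonferroni's inequality is a term of the exponential
    series of the area of the disc, so it vanishes as the order grows. *)
Lemma disc_void_le_prod J :
  fine (P disc_void) <= \prod_(j < J) (1 - disc_eigenvalue rho j).
Proof.
have l01 j : 0 <= disc_eigenvalue rho j <= 1.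
  by rewrite disc_eigenvalue_ge0 disc_eigenvalue_le1.
pose S := fine (@plane_lebesgue R (disc rho)).
have key m : fine (P disc_void) <=
    \prod_(j < J) (1 - disc_eigenvalue rho j) + S ^+ m.*2.+1 / m.*2.+1`!%:R.
  apply: le_trans (disc_void_le_alternating m) _.
  have cv : \sum_(k < m.*2.+1) (-1) ^+ k * (injective_sum (disc_eigenvalue rho) k M / k`!%:R)
      @[M --> \oo] --> \sum_(k < m.*2.+1)
    (-1) ^+ k * (\int[P]_w ((disc_count w ^_ k)%:R) / k`!%:R).
    elim: (m.*2.+1) => [|K IHK].
      by under eq_fun do rewrite big_ord0; rewrite big_ord0; exact: cvg_cst.
    under eq_fun do rewrite big_ord_recr; rewrite big_ord_recr /=.
    apply: cvgD => //; apply: cvgM; first exact: cvg_cst.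
    by apply: cvgM; [exact: (disc_factorial_moment K).2|exact: cvg_cst].
  apply: (cvgr_to_le cv).
  near=> M.
  apply: le_trans (alternating_injective_sum l01 m M) _.
  apply: lerD.
    apply: prod_complement_le => //; near: M; exact: nbhs_infty_ge.
  rewrite ler_wpM2r ?invr_ge0 // lerXn2r ?nnegrE //.
  - by apply: sumr_ge0 => j _; exact: disc_eigenvalue_ge0.
  - exact: fine_ge0.
  - exact: sum_disc_eigenvalue_le.
have lim0 : S ^+ m.*2.+1 / m.*2.+1`!%:R @[m --> \oo] --> 0.
  apply: (cvg_comp (fun m => m.*2.+1) (exp_coeff S) _ (@cvg_exp_coeff R S)).
  apply/cvgnyPge => A; near=> m.
  apply: (@leq_trans m); first by near: m; exact: nbhs_infty_ge.
  by rewrite -addnn -addnS leq_addr.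
have cv : \prod_(j < J) (1 - disc_eigenvalue rho j) + S ^+ m.*2.+1 / m.*2.+1`!%:R
    @[m --> \oo] --> \prod_(j < J) (1 - disc_eigenvalue rho j).
  by rewrite -[X in _ --> X]addr0; apply: cvgD => //; exact: cvg_cst.
by apply: (cvgr_to_ge cv); apply: nearW => m; exact: key.
Unshelve. all: by end_near.
Qed.

(** Only the first [rho ^+ 2 / 2] eigenvalues are used: each of them is within
    [expR (- (rho ^+ 2 / 2))] of 1. *)
Lemma void_probability_le : 2 <= rho ^+ 2 ->
  fine (P disc_void) <= expR (- rho ^+ 4 / 8).
Proof.
move=> rho2; (* With [j] below [rho ^+ 2 / 2], the factor [2 ^+ j.+1] does not spoil the
   Gaussian factor, and there are still at least [rho ^+ 2 / 4] factors. *)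
pose J := Num.truncn (rho ^+ 2 / 2).
have h0 : 0 <= rho ^+ 2 / 2 by lra.
have /andP[J1 J2] := truncn_itv h0.
have J3 : rho ^+ 2 / 4 <= J%:R.
  have : 1 <= J%:R :> R by rewrite ler1n truncn_gt0; lra.
  by have := pi_ge2 R; move: (pi : R) => p; lra.
apply: le_trans (disc_void_le_prod J) _.
apply: (@le_trans _ _ (\prod_(j < J) expR (- (rho ^+ 2 / 2)))).
  apply: ler_prod => j _; rewrite subr_ge0 disc_eigenvalue_le1 /=.
  apply: le_trans (disc_eigenvalue_complement_le _ _) _.
  have e2 : 2 <= expR 1 :> R by have := expR_ge1Dx (1 : R); lra.
  apply: (@le_trans _ _ (expR (rho ^+ 2 / 2) * expR (- rho ^+ 2))); last first.
    by rewrite -expRD ler_expR; lra.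
  apply: ler_pM; rewrite ?exprn_ge0 ?expR_ge0 //.
    apply: (@le_trans _ _ (expR 1 ^+ J)).
      apply: (@le_trans _ _ (2 ^+ J)); first by rewrite ler_weXn2l ?ler1n.
      by rewrite lerXn2r ?nnegrE ?expR_ge0.
    by rewrite -expRM_natl mulr1 ler_expR.
  rewrite ler_expR mulNr lerN2 ler_peMl ?sqr_ge0 //.
  by have := pi_ge2 R; lra.
rewrite prodr_const card_ord -expRM_natl ler_expR.
have -> : rho ^+ 4 = rho ^+ 2 * rho ^+ 2 by rewrite -exprD.
have : 0 <= (J%:R - rho ^+ 2 / 4) * (rho ^+ 2) by rewrite mulr_ge0 ?subr_ge0 ?sqr_ge0.
lra.
Qed.

End void_probability.

(** * Dense points in the window *)

Section dense_window.
Context {R : realType}.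
Local Notation plane := (plane R).
Variables (n M : nat) (s : R).
Hypotheses (s0 : 0 < s) (M0 : (0 < M)%N) (sM : s * M%:R = Num.sqrt n%:R).

Let h : R := Num.sqrt n%:R / 2.

(** The window is cut into [M * M] squares of side [s], listed in
    lexicographic order. *)
Definition square_centre (i : nat) : plane :=
  (- (Num.sqrt n%:R / 2) + s * (i %/ M)%:R + s / 2,
   - (Num.sqrt n%:R / 2) + s * (i %% M)%:R + s / 2).

Lemma windowP (x : plane) : window n x <->
  [/\ - h <= x.1, x.1 <= h, - h <= x.2 & x.2 <= h].
Proof.
rewrite /window /= !in_itv /=; split=> [[/andP[? ?] /andP[? ?]]|[? ? ? ?]] //.
by split; apply/andP.
Qed.

Lemma coordinate_cell (y : R) : - h <= y -> y <= h ->
  exists2 i, (i < M)%N & s * i%:R <= y + h /\ y + h <= s * i%:R + s.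
Proof.
move=> y1 y2; pose u := (y + h) / s.
have u0 : 0 <= u by apply: divr_ge0; [lra|exact: ltW].
have uE : y + h = s * u by rewrite /u mulrC divfK // gt_eqF.
have [uM|uM] := ltP u M%:R.
  have /andP[h1 h2] := truncn_itv u0; rewrite -natr1 in h2.
  exists (Num.truncn u); first by rewrite -(ltr_nat R); exact: le_lt_trans uM.
  rewrite uE -[X in _ + X]mulr1 -mulrDr !ler_pM2l //; lra.
(* The right end of the window belongs to the last square. *)
exists M.-1; first by rewrite prednK.
have ME : M%:R = M.-1%:R + 1 :> R by rewrite natr1 prednK.
have : u <= M%:R by rewrite -(ler_pM2l s0) -uE sM; rewrite /h in y2 *; lra.
move=> uM'; rewrite uE -[X in _ + X]mulr1 -mulrDr !ler_pM2l //; lra.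
Qed.

Lemma disc_at_square i x : disc_at (square_centre i) (s / 2) x ->
  [/\ - h + s * (i %/ M)%:R <= x.1, x.1 <= - h + s * (i %/ M)%:R + s,
      - h + s * (i %% M)%:R <= x.2 & x.2 <= - h + s * (i %% M)%:R + s].
Proof.
rewrite /disc_at /= /disc /= /sqnorm /recentre /= => hx.
set c1 := (X in x.1 - X) in hx; set c2 := (X in x.2 - X) in hx.
have s2 : 0 <= s / 2 by rewrite divr_ge0 // ltW.
have h1 : `|x.1 - c1| <= s / 2.
  rewrite -(ler_sqr (normr_ge0 _)) ?nnegrE // real_normK ?num_real //.
  by have := sqr_ge0 (x.2 - c2); lra.
have h2 : `|x.2 - c2| <= s / 2.
  rewrite -(ler_sqr (normr_ge0 _)) ?nnegrE // real_normK ?num_real //.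
  by have := sqr_ge0 (x.1 - c1); lra.
move: h1 h2; rewrite !ler_norml => /andP[h1 h2] /andP[h3 h4].
by rewrite /c1 /c2 in h1 h2 h3 h4; rewrite /h; split; lra.
Qed.

(** Two points of a square of side [s] are at distance at most [2 * s], hence
    at most [r / 20]. *)
Lemma dense_betti0 (k : nat) (Q : set plane) (r : R) : (1 <= k)%N ->
  finite_set (Q `&` window n) -> 40 * s <= r ->
  (forall i, (i < M * M)%N -> Q `&` disc_at (square_centre i) (s / 2) !=set0) ->
  betti k (rips (fset_set (Q `&` window n)) r) = 0%N.
Proof.
move=> k1 finQ sr hit.
have r0 : 0 < r by have := s0; lra.
have h0 : 0 <= h by rewrite divr_ge0 // sqrtr_ge0.
set X := fset_set _; rewrite rips_flag.
have XE x : (x \in X) = (x \in Q `&` window n) by rewrite in_fset_set.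
apply: dismantlable_betti0 => //.
- by move=> x; rewrite /close edistxx ltW.
- by move=> x y; rewrite /close edistC.
apply: (@dismantlable_dense R X (fun x => val x) r (window n) r0).
- by apply/windowP; split => /=; lra.
- move=> t x y t0 t1 /windowP[x1 x2 x3 x4] /windowP[y1 y2 y3 y4].
  have cvx u v b : u <= b -> v <= b -> (1 - t) * u + t * v <= b.
    move=> ub vb; have := ler_wpM2l t0 vb.
    have := ler_wpM2l (_ : 0 <= 1 - t) ub; rewrite subr_ge0 => /(_ t1); lra.
  have cvx' u v b : b <= u -> b <= v -> b <= (1 - t) * u + t * v.
    move=> ub vb; have := ler_wpM2l t0 vb.
    have := ler_wpM2l (_ : 0 <= 1 - t) ub; rewrite subr_ge0 => /(_ t1); lra.
  by apply/windowP; split; rewrite /lerp /=; [exact: cvx'|exact: cvx|exact: cvx'|exact: cvx].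
- by move=> v; have := fsvalP v; rewrite XE => /set_mem[].
move=> q /windowP[q1 q2 q3 q4].
have [i iM [i1 i2]] := coordinate_cell q1 q2.
have [j jM [j1 j2]] := coordinate_cell q3 q4.
have idx : (i * M + j < M * M)%N.
  by rewrite (leq_trans (_ : _ < i.+1 * M)%N) ?leq_mul2r ?iM ?orbT // mulSnr ltn_add2l.
have [x [Qx Dx]] := hit _ idx.
have := disc_at_square Dx; rewrite divnMDl // (divn_small jM) addn0 modnMDl modn_small //.
move=> [x1 x2 x3 x4].
have siM : s * i%:R + s <= s * M%:R.
  by rewrite -[X in _ + X]mulr1 -mulrDr ler_pM2l // natr1 ler_nat.
have sjM : s * j%:R + s <= s * M%:R.
  by rewrite -[X in _ + X]mulr1 -mulrDr ler_pM2l // natr1 ler_nat.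
have si0 : 0 <= s * i%:R by rewrite mulr_ge0 // ltW.
have sj0 : 0 <= s * j%:R by rewrite mulr_ge0 // ltW.
have hh : h + h = s * M%:R by rewrite sM /h; lra.
have xX : x \in X.
  by rewrite XE; apply/mem_set; split => //; apply/windowP; split; lra.
exists [` xX]%fset => /=; apply: edist_le; first by rewrite divr_ge0 // ltW.
rewrite edist_sqr.
have sq (y z : R) : `|y - z| <= s -> (y - z) ^+ 2 <= s ^+ 2.
  by move=> yz; rewrite -[leLHS]real_normK ?num_real // ler_sqr ?nnegrE // ltW.
have d1 : (x.1 - q.1) ^+ 2 <= s ^+ 2 by apply: sq; rewrite ler_norml; apply/andP; split; lra.
have d2 : (x.2 - q.2) ^+ 2 <= s ^+ 2 by apply: sq; rewrite ler_norml; apply/andP; split; lra.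
have : (2 * s) ^+ 2 <= (r / 20) ^+ 2.
  by rewrite ler_sqr ?nnegrE ?mulr_ge0 ?divr_ge0 ?(ltW s0) ?(ltW r0) //; lra.
rewrite exprMn; have := sqr_ge0 s; lra.
Qed.

End dense_window.

Section final_estimate.
Context {R : realType} {d : measure_display} {Omega : measurableType d}.
Variables (P : probability Omega R) (Phi : Omega -> set (plane R)).
Hypothesis ginPhi : ginibre P Phi.

Lemma bounded_window n : bounded_set (window n : set (plane R)).
Proof.
exists (Num.sqrt n%:R / 2); split; first exact: num_real.
move=> N ltN x /windowP[x1 x2 x3 x4] /=; apply: le_trans (ltW ltN).
by rewrite prod_normE ge_max !ler_norml x1 x2 x3 x4.
Qed.

Lemma finite_window n w : finite_set (Phi w `&` window n).
Proof. by case: ginPhi => -[h _] _; exact/h/bounded_window. Qed.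

Lemma measurable_window n : measurable (window n : set (plane R)).
Proof. by apply: measurableX; exact: measurable_itv. Qed.

Lemma measurable_vanishing k n (r : R) :
  measurable [set w | betti k (rips (fset_set (Phi w `&` window n)) r) = 0%N].
Proof.
apply: measurable_betti_event; first exact: finite_window.
- exact: ginPhi.1.2.
- exact: measurable_window.
Qed.

Lemma vanishing_probability_ge k n M (s r : R) : (1 <= k)%N -> (0 < M)%N ->
  s * M%:R = Num.sqrt n%:R -> 2 * Num.sqrt 2 <= s -> 40 * s <= r ->
  ((1 - (M * M)%:R * expR (- s ^+ 4 / 128))%:E <=
   P [set w | betti k (rips (fset_set (Phi w `&` window n)) r) = 0%N])%E.
Proof.
move=> k1 M0 sM s2 sr.
have s0 : 0 < s by apply: lt_le_trans s2; rewrite mulr_gt0 // sqrtr_gt0.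
set E := [set w | _].
have mE : measurable E := measurable_vanishing k n r.
pose V i := disc_void Phi (square_centre n M s i) (s / 2).
have mV i : measurable (V i) by exact: measurable_disc_void ginPhi _ _.
have sub : ~` E `<=` \big[setU/set0]_(i < M * M) V i.
  move=> w nE; rewrite -bigcup_mkord; apply: contrapT => nV; apply: nE.
  apply: (dense_betti0 s0 M0 sM k1 (finite_window n w) sr) => i iM.
  apply/set0P/eqP => h0; apply: nV; exists i => //.
  by rewrite /V /disc_void /disc_count /= h0 fset_set0 cardfs0.
have Vle i : (P (V i) <= (expR (- s ^+ 4 / 128))%:E)%E.
  have s8 : 2 <= (s / 2) ^+ 2.
    have : (2 * Num.sqrt 2) ^+ 2 <= s ^+ 2.
      by rewrite ler_sqr ?nnegrE ?mulr_ge0 ?sqrtr_ge0 ?(ltW s0).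
    rewrite exprMn sqr_sqrtr // expr_div_n; lra.
  have := void_probability_le ginPhi (square_centre n M s i) s8.
  rewrite -(fineK (fin_num_measure P _ (mV i))) lee_fin => h; apply: le_trans h _.
  by rewrite ler_expR expr_div_n; lra.
have cE : (P (~` E) <= ((M * M)%:R * expR (- s ^+ 4 / 128))%:E)%E.
  apply: (le_trans (content_subadditive P (fun i _ => mV i) (measurableC mE) sub)).
  apply: (@le_trans _ _ (\sum_(i < M * M) (expR (- s ^+ 4 / 128))%:E)%E).
    by apply: lee_sum => i _; exact: Vle.
  by rewrite sumEFin sumr_const card_ord mulr_natl.
rewrite -[E]setCK probability_setC; last exact: measurableC.
by rewrite EFinB leeB.
Qed.

End final_estimate.


(** * The theorem *)

Unset Implicit Arguments.

Theorem theorem4p7 (R : realType) (k : nat) (hk : (1 <= k)%N) :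
  exists C : R, 0 < C /\
    forall (d : measure_display) (Omega : measurableType d)
      (P : probability Omega R) (Phi : Omega -> set (plane R)),
      ginibre P Phi ->
      forall r : nat -> R,
        (forall n : nat, (1 <= n)%N -> C * (ln n%:R `^ (4^-1)) <= r n) ->
        P [set w | betti k (rips (fset_set (Phi w `&` window n)) (r n)) = 0%N]
          @[n --> \oo] --> 1%E.
Proof.
(* 320 = 40 * 2 * 4: the squares have side at most 2 * 4 (ln n) ^ (1/4), and
   density at scale [r] needs [40 * s <= r]. *)
exists 320; split=> // d Omega P Phi ginPhi r hr.
pose E n := [set w | betti k (rips (fset_set (Phi w `&` window n)) (r n)) = 0%N].
have lim1 : (1 - 2 * harmonic n : R)%:E @[n --> \oo] --> (1 : R)%:E.
  apply: cvg_EFin; first exact: nearW.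
  rewrite -[X in _ --> X](subr0 1) -[X in _ - X](mulr0 2).
  by apply: cvgB; [exact: cvg_cst|apply: cvgM; [exact: cvg_cst|exact: cvg_harmonic]].
apply: (squeeze_cvge _ lim1 (cvg_cst _)); near=> n.
have n256 : (256 <= n)%N by near: n; exact: nbhs_infty_ge.
have en : expR 1 <= n%:R :> R by near: n; exact: nbhs_infty_ger.
have mE : measurable (E n) := measurable_vanishing ginPhi k n (r n).
rewrite probability_le1 // andbT.
have n0 : 0 < n%:R :> R by exact: lt_le_trans (expR_gt0 _) en.
pose L := ln n%:R `^ (4^-1) : R.
have ln1 : 1 <= ln n%:R :> R by rewrite -[leLHS](expRK 1) ler_ln ?posrE ?expR_gt0.
have L4 : L ^+ 4 = ln n%:R.
  by rewrite -powR_mulrn ?powR_ge0 // -powRrM mulVf // powRr1 // (le_trans _ ln1).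
have L1 : 1 <= L.
  by rewrite leNgt; apply/negP => Lt; move: ln1; rewrite -L4 leNgt exprn_ilt1 ?powR_ge0.
pose l := 4 * L; have l0 : 0 < l by rewrite /l; lra.
(* Since 256 = 2 * 128, a disc is empty with probability at most n ^ (-2). *)
have l4 : l ^+ 4 = 256 * ln n%:R.
  by rewrite /l exprMn L4; congr (_ * _); ring.
have ln_le : l <= Num.sqrt n%:R.
  rewrite -(@ler_pXn2r _ 4) ?nnegrE ?sqrtr_ge0 ?(ltW l0) // l4.
  have -> : Num.sqrt n%:R ^+ 4 = n%:R * n%:R :> R.
    by rewrite (exprM _ 2 2) sqr_sqrtr ?expr2 // ltW.
  by apply: ler_pM; rewrite ?ler0n ?(le_trans _ ln1) ?ler_nat // ltW // ln_sublinear.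
pose M := Num.truncn (Num.sqrt n%:R / l).
have q0 : 0 <= Num.sqrt n%:R / l by rewrite divr_ge0 ?sqrtr_ge0 // ltW.
have /andP[M1 M2] := truncn_itv q0.
have M0 : (0 < M)%N by rewrite truncn_gt0 ler_pdivlMr // mul1r.
have MR0 : 0 < M%:R :> R by rewrite ltr0n.
pose s : R := Num.sqrt n%:R / M%:R.
have sM : s * M%:R = Num.sqrt n%:R by rewrite /s divfK // gt_eqF.
have ls : l <= s by rewrite ler_pdivlMr // mulrC -ler_pdivlMr.
have sl : s <= 2 * l.
  rewrite ler_pdivrMr //; move: M2; rewrite ltr_pdivrMr // -natr1 => M2.
  have : 1 * l <= M%:R * l by rewrite ler_pM2r // ler1n.
  lra.
have s2 : 2 * Num.sqrt 2 <= s.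
  apply: le_trans ls; have : Num.sqrt 2 <= 2 :> R.
    by rewrite -[leRHS]ger0_norm // -sqrtr_sqr ler_wsqrtr // expr2; lra.
  rewrite /l; lra.
have sr : 40 * s <= r n.
  apply: le_trans (hr n _); last by rewrite (leq_trans _ n256).
  rewrite -/L; move: sl; rewrite /l; lra.
apply: le_trans (vanishing_probability_ge ginPhi hk M0 sM s2 sr).
rewrite lee_fin lerD2l lerN2.
have Mn : (M * M)%:R <= n%:R :> R.
  have Ms : M%:R <= Num.sqrt n%:R :> R.
    by rewrite -sM ler_peMl ?ler0n //; move: ls; rewrite /l; lra.
  rewrite natrM -[leRHS]sqr_sqrtr ?(ltW n0) // expr2.
  by apply: ler_pM; rewrite ?ler0n.
have en2 : expR (- s ^+ 4 / 128) <= n%:R^-1 * n%:R^-1.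
  have -> : n%:R^-1 = expR (- ln n%:R) :> R by rewrite expRN lnK // posrE.
  rewrite -expRD ler_expR.
  have : l ^+ 4 <= s ^+ 4 by rewrite ler_pXn2r ?nnegrE ?(ltW l0) // (le_trans (ltW l0)).
  rewrite l4; lra.
apply: (@le_trans _ _ (n%:R * (n%:R^-1 * n%:R^-1))).
  by apply: ler_pM; rewrite ?ler0n ?expR_ge0.
rewrite mulrA divff ?gt_eqF // mul1r /harmonic /=.
rewrite -[leLHS]mul1r ler_pdivrMr // mulrAC ler_pdivlMr ?ltr0n // mul1r -natr1.
have : 1 <= n%:R :> R by rewrite ler1n (leq_trans _ n256).
lra.
Unshelve. all: by end_near.
Qed.
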